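(* Let $\Sigma$ be a finite complete fan in $N_{\mathbb{R}}$ consisting of strongly convex rational polyhedral cones, let $X_\Sigma$ be the associated toric variety over $\mathbb{C}$, let $h \colon N_{\mathbb{R}} \to \mathbb{R}$ be a support function on $\Sigma$, and let $L_h$ be the associated line bundle on $X_\Sigma$. Then the rational function $$R(\Sigma,h) = \sum_{\sigma \in \Sigma,\ \dim \sigma = n} R(-h_\sigma + \sigma^\vee)$$ is a Laurent polynomial. For each $\mathbf{a} \in M$, the coefficient of the monomial $x^{\mathbf{a}}$ in $R(\Sigma,h)$ is the Euler characteristic of $H^*(X_\Sigma; L_h)_{\mathbf{a}}$, i.e. it is $$\chi(L_h)_{\mathbf{a}} = \sum_{k=0}^n (-1)^k \dim_{\mathbb{C}} H^k(X_\Sigma; L_h)_{\mathbf{a}} .$$ In short, $$R(\Sigma,h) = \sum_{\mathbf{a} \in M} \chi(L_h)_{\mathbf{a}} \cdot x^{\mathbf{a}} .$$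
   Context: $M \cong \mathbb{Z}^n$ is a lattice of rank $n$, $N = \mathrm{Hom}_{\mathbb{Z}}(M,\mathbb{Z})$ is its dual, $M_{\mathbb{R}} = M \otimes \mathbb{R}$, $N_{\mathbb{R}} = N \otimes \mathbb{R}$, with the evaluation pairing $\langle x, y\rangle = y(x)$ for $x \in M_{\mathbb{R}}$, $y \in N_{\mathbb{R}}$; one identifies $\mathrm{Hom}_{\mathbb{Z}}(N,\mathbb{Z}) = M$. For a cone $\sigma \subset N_{\mathbb{R}}$, $\sigma^\vee = \{x \in M_{\mathbb{R}} : \langle x,y\rangle \ge 0 \text{ for all } y \in \sigma\}$. Laurent series: $S = \mathrm{map}(M,\mathbb{C})$ is the set of formal Laurent series, $x^{\mathbf{b}} \in S$ (for $\mathbf{b}\in M$) is the map with value $1$ at $\mathbf{b}$ and $0$ elsewhere, $P \subset S$ is the set of finitely supported maps. $P$ is a ring under convolution (the ring of Laurent polynomials in $n$ indeterminates), and $S$ is a $P$-module by the same formula. For $K \subseteq M_{\mathbb{R}}$ put $R[K] = \sum_{\mathbf{a} \in M \cap K} x^{\mathbf{a}} \in S$. If $K = \mathbf{b} + C$ with $\mathbf{b} \in M$ and $C$ a pointed rational polyhedral cone in $M_{\mathbb{R}}$, the series $R[K]$ represents a rational function, denoted $R(K) \in Q(P)$, where $Q(P)$ is the quotient field of $P$ (i.e. $R(K) = q/p$ for any $p,q \in P$, $p \neq 0$, with $p \cdot R[K] = q$ in $S$). Support function: $h \colon N_{\mathbb{R}} \to \mathbb{R}$ such that for every $\sigma \in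 \Sigma$ there is $h_\sigma \in \mathrm{Hom}_{\mathbb{Z}}(N,\mathbb{Z}) = M$ with $h|_\sigma = (h_\sigma \otimes \mathrm{id}_{\mathbb{R}})|_\sigma$. Line bundle: $X_\Sigma$ is glued from the affine schemes $U_\sigma = \mathrm{Spec}\,\mathbb{C}[M \cap \sigma^\vee]$, $\sigma \in \Sigma$. The line bundle $L_h$ has as sections over $U_\sigma$ the free $\mathbb{C}[M\cap\sigma^\vee]$-submodule of rank $1$ of $\mathbb{C}[M]$ with basis the element $-h_\sigma \in M$, and restriction maps are inclusions inside $\mathbb{C}[M]$. Thus all these modules are $M$-graded. Grading on cohomology: the unit sphere $S^{n-1} \subset N_{\mathbb{R}}$ is a regular CW complex with cells $\bar\sigma = \sigma \cap S^{n-1}$ ($\sigma \in \Sigma$, including the empty cell $\bar 0$); fix orientations and denote the incidence numbers of cells by $[\bar\sigma:\bar\tau] \in \{-1,0,1\}$, with $[\bar\tau:\bar 0]=1$ for $1$-dimensional $\tau$. The sheaf cohomology $H^k(X_\Sigma;L_h)$ is the $k$-th cohomology of the cochain complex $\mathcal{C}^d = \bigoplus_{\mathrm{codim}\,\sigma = d} \Gamma(U_\sigma; L_h)$ with differential given on summands by $[\bar\sigma:\bar\tau]$ times the restriction map. This complex is $M$-graded with homogeneous differentials of degree $0$, which gives $H^k(X_\Sigma;L_h) = \bigoplus_{\mathbf{b}\in M} H^k(X_\Sigma;L_h)_{\mathbf{b}}$, where $H^k(X_\Sigma;L_h)_{\mathbf{b}}$ is the $k$-th cohomology of the degree-$\mathbf{b}$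 subcomplex $\mathcal{C}^d_{\mathbf{b}} = \bigoplus_{\mathrm{codim}\,\sigma = d,\ \mathbf{b}+h_\sigma \in \sigma^\vee} \mathbb{C}$. *)

(* Defs.v *)
From HB Require Import structures.
From mathcomp Require Import all_boot all_order all_algebra fraction complex.
From mathcomp Require Import finmap.
From mathcomp Require Import all_classical reals.

Set Implicit Arguments.
Unset Strict Implicit.
Unset Printing Implicit Defensive.

Import Order.TTheory GRing.Theory Num.Theory.

Local Open Scope classical_set_scope.
Local Open Scope ring_scope.

(** * Formal Laurent series and Laurent polynomials, M = Z^n *)

(* Meant for finitely supported p; a sum with infinitely many nonzero terms is 0
   by convention. *)
Definition conv (F : fieldType) (n : nat) (p f : 'rV[int]_n -> F) :
    'rV[int]_n -> F :=
  fun a => \sum_(b \in [set b | p b != 0]) p b * f (a - b).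

Definition finsupported (F : fieldType) (n : nat) : {pred 'rV[int]_n -> F} :=
  fun f => `[< finite_set [set b | f b != 0] >].

Record laurent (F : fieldType) (n : nat) := Laurent {
  lcoef :> 'rV[int]_n -> F;
  lcoefP : lcoef \in @finsupported F n }.

HB.instance Definition _ (F : fieldType) (n : nat) :=
  [isSub for @lcoef F n].
HB.instance Definition _ (F : fieldType) (n : nat) :=
  [Choice of laurent F n by <:].

Lemma finsupported_closed (F : fieldType) n : zmod_closed (@finsupported F n).
Proof.
split=> [|f g /asboolP fin_f /asboolP fin_g]; apply/asboolP.
  apply: (sub_finite_set (B := set0)) => [b /=|]; last exact: finite_set0.
  by rewrite eqxx.
have fin : finite_set ([set b | f b != 0] `|` [set b | g b != 0]).
  by rewrite finite_setU; split.
apply: sub_finite_set fin => b /= fgb.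
apply: contrapT => /not_orP[/negP/negPn/eqP fb0 /negP/negPn/eqP gb0].
by case/negP: fgb; rewrite /GRing.add /GRing.opp /= fb0 gb0 subrr.
Qed.

HB.instance Definition _ (F : fieldType) (n : nat) :=
  GRing.isZmodClosed.Build _ (@finsupported F n) (@finsupported_closed F n).
HB.instance Definition _ (F : fieldType) (n : nat) :=
  [SubChoice_isSubZmodule of laurent F n by <:].

Lemma lcoef_finite (F : fieldType) n (p : laurent F n) : finite_set [set b | p b != 0].
Proof. exact/asboolP/lcoefP. Qed.

Lemma mem_lsupp (F : fieldType) n (p : laurent F n) b :
  (b \in fset_set [set b | p b != 0]) = (p b != 0).
Proof.
by rewrite in_fset_set; [apply/idP/idP; rewrite inE|exact: lcoef_finite].
Qed.

Lemma laurentP (F : fieldType) n (p q : laurent F n) : (forall a, p a = q a) -> p = q.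
Proof. by move=> pq; apply/val_inj/funext. Qed.

Lemma lcoefD (F : fieldType) n (p q : laurent F n) a : (p + q) a = p a + q a.
Proof. by []. Qed.

Lemma lcoef0 (F : fieldType) n a : (0 : laurent F n) a = 0.
Proof. by []. Qed.

Lemma conv_seq (F : fieldType) n (p f : 'rV[int]_n -> F) (a : 'rV[int]_n)
    (s : seq 'rV[int]_n) :
  finite_set [set b | p b != 0] -> uniq s ->
  (forall b, p b * f (a - b) != 0 -> b \in s) ->
  conv p f a = \sum_(b <- s) p b * f (a - b).
Proof.
move=> fin_p us covs; rewrite /conv fsbig_finite //=.
have big_nz r : \sum_(b <- r) p b * f (a - b) =
    \sum_(b <- [seq b <- r | p b * f (a - b) != 0]) p b * f (a - b).
  rewrite big_filter [RHS]big_mkcond; apply: eq_bigr => b _.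
  by case: eqP.
rewrite big_nz [RHS]big_nz; apply: perm_big; apply: uniq_perm.
- exact/filter_uniq/fset_uniq.
- exact: filter_uniq.
move=> b; rewrite !mem_filter; case: (boolP (_ != 0)) => //= nz.
rewrite (covs b nz) in_fset_set //; apply/asboolP => /=.
by apply: contra nz => /eqP ->; rewrite mul0r.
Qed.

Lemma conv_neq0 (F : fieldType) n (p f : 'rV[int]_n -> F) (a : 'rV[int]_n) :
  conv p f a != 0 -> exists b, p b != 0 /\ f (a - b) != 0.
Proof.
move=> nz; apply: contrapT => nex; case/negP: nz; apply/eqP.
rewrite /conv fsbig1 // => b /= pb; apply/eqP; rewrite mulf_eq0 (negbTE pb) /=.
by apply: contrapT => /negP fb; apply: nex; exists b.
Qed.

Lemma conv_finsupported (F : fieldType) n (p q : laurent F n) :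
  conv p q \in @finsupported F n.
Proof.
apply/asboolP; have := finite_image2 (fun b c => b + c) (lcoef_finite p)
  (lcoef_finite q).
apply: sub_finite_set => a /= /conv_neq0[b [pb qb]].
by exists b => //; exists (a - b) => //; rewrite addrC subrK.
Qed.

Lemma delta_finsupported (F : fieldType) n (b : 'rV[int]_n) :
  (fun a => (a == b)%:R : F) \in @finsupported F n.
Proof.
apply/asboolP; apply: sub_finite_set (finite_set1 b) => a /=.
by case: (a =P b) => // _; rewrite eqxx.
Qed.

(* the monomial x^b *)
Definition lmonom (F : fieldType) (n : nat) (b : 'rV[int]_n) : laurent F n :=
  Laurent (delta_finsupported F b).

Definition lmul (F : fieldType) (n : nat) (p q : laurent F n) : laurent F n :=
  Laurent (conv_finsupported p q).

Lemma conv_fset (F : fieldType) n (p : laurent F n) (f : 'rV[int]_n -> F) a :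
  conv p f a = \sum_(b <- fset_set [set b | p b != 0]) p b * f (a - b).
Proof. by rewrite /conv fsbig_finite //=; exact: lcoef_finite. Qed.

Lemma conv_monom (F : fieldType) n (b : 'rV[int]_n) (f : 'rV[int]_n -> F) a :
  conv (lmonom F b) f a = f (a - b).
Proof.
rewrite (@conv_seq _ _ _ _ _ [:: b]) //=.
- by rewrite big_seq1 eqxx mul1r.
- exact: (lcoef_finite (lmonom F b)).
- by move=> c; rewrite inE /=; case: (c == b) => //; rewrite mul0r eqxx.
Qed.

Lemma conv_assoc (F : fieldType) n (p q : laurent F n) (f : 'rV[int]_n -> F) :
  conv (lmul p q) f = conv p (conv q f).
Proof.
apply/funext => a; rewrite [RHS]conv_fset.
set sp := fset_set _; pose sq := fset_set [set b | q b != 0].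
pose s := undup [seq b + c | b <- sp, c <- sq].
have sP b c : p b != 0 -> q c != 0 -> b + c \in s.
  by move=> pb qc; rewrite mem_undup; apply: allpairs_f; rewrite mem_lsupp.
rewrite (@conv_seq _ _ _ _ _ s).
- transitivity (\sum_(d <- s) \sum_(b <- sp) p b * (q (d - b) * f (a - d))).
    apply: eq_bigr => d _; rewrite /= conv_fset mulr_suml.
    by apply: eq_bigr => b _; rewrite mulrA.
  rewrite exchange_big /= [LHS]big_seq [RHS]big_seq.
  apply: eq_bigr => b; rewrite mem_lsupp => pb; rewrite -mulr_sumr; congr (_ * _).
  rewrite (@conv_seq _ _ _ _ _ [seq d - b | d <- s]).
  + rewrite big_map; apply: eq_bigr => d _.
    by rewrite opprB addrA subrK.
  + exact: lcoef_finite.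
  + by rewrite map_inj_uniq ?undup_uniq//; exact: addIr.
  + move=> c; rewrite mulf_eq0 negb_or => /andP[qc _].
    by apply/mapP; exists (b + c); rewrite ?sP// addrC addKr.
- exact: (lcoef_finite (lmul p q)).
- exact: undup_uniq.
- move=> d; rewrite mulf_eq0 negb_or => /andP[/conv_neq0[b [pb qb]] _].
  by have := sP _ _ pb qb; rewrite addrC subrK.
Qed.

Lemma lmulA (F : fieldType) n : associative (@lmul F n).
Proof. by move=> p q r; apply/val_inj; rewrite /= conv_assoc. Qed.

Lemma lmulC (F : fieldType) n : commutative (@lmul F n).
Proof.
move=> p q; apply: laurentP => a /=; rewrite [RHS]conv_fset.
rewrite (@conv_seq _ _ _ _ _
  [seq a - c | c <- fset_set [set b | q b != 0]]).
- rewrite big_map; apply: eq_bigr => c _.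
  by rewrite opprB addrCA subrr addr0 mulrC.
- exact: lcoef_finite.
- by rewrite map_inj_uniq ?fset_uniq// => b c /addrI/oppr_inj.
- move=> b; rewrite mulf_eq0 negb_or => /andP[_ qb].
  apply/mapP; exists (a - b); last by rewrite opprB addrCA subrr addr0.
  by rewrite mem_lsupp.
Qed.

Lemma lmul1p (F : fieldType) n : left_id (lmonom F (0 : 'rV[int]_n)) (@lmul F n).
Proof. by move=> p; apply: laurentP => a /=; rewrite conv_monom subr0. Qed.

Lemma conv_addr (F : fieldType) n (p : laurent F n) (f g : 'rV[int]_n -> F) :
  conv p (f + g) = conv p f + conv p g.
Proof.
apply/funext => a; transitivity (conv p f a + conv p g a) => //.
rewrite !conv_fset -big_split /=.
by apply: eq_bigr => b _; rewrite -mulrDr.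
Qed.

Lemma lmulDl (F : fieldType) n : left_distributive (@lmul F n) +%R.
Proof.
move=> p q r; rewrite ![lmul _ r]lmulC; apply/val_inj => /=.
exact: conv_addr.
Qed.

Lemma lmonom_neq0 (F : fieldType) n b : lmonom F b != 0 :> laurent F n.
Proof.
apply/eqP => /(congr1 (fun p : laurent F n => p b)) /=.
by rewrite eqxx => /eqP; rewrite oner_eq0.
Qed.

HB.instance Definition _ (F : fieldType) (n : nat) :=
  GRing.Zmodule_isComNzRing.Build (laurent F n)
    (@lmulA F n) (@lmulC F n) (@lmul1p F n) (@lmulDl F n) (@lmonom_neq0 F n 0).

(* Lexicographic order on M, used to show that there are no zero divisors. *)
Definition lexlt n (a b : 'rV[int]_n) : Prop :=
  exists i : 'I_n, a 0 i < b 0 i /\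
    forall j : 'I_n, (j < i)%N -> a 0 j = b 0 j.

Lemma lexlt_total n (a b : 'rV[int]_n) : a <> b -> lexlt a b \/ lexlt b a.
Proof.
move=> ab; have [i0 ne0] : exists i, a 0 i != b 0 i.
  apply: contrapT => nex; apply: ab; apply/rowP => i; apply/eqP.
  by apply: contrapT => /negP ne; apply: nex; exists i.
case: (@arg_minnP _ i0 (fun i => a 0 i != b 0 i) val ne0) => i nei mini.
have eqj (j : 'I_n) : (j < i)%N -> a 0 j = b 0 j.
  move=> ji; apply/eqP; apply: contraLR ji => nej.
  by rewrite -leqNgt; exact: mini.
case: (ltgtP (a 0 i) (b 0 i)) => [lt|gt|eq]; last by rewrite eq eqxx in nei.
  by left; exists i.
by right; exists i; split=> // j /eqj.
Qed.

Lemma lexlt_irr n (a : 'rV[int]_n) : ~ lexlt a a.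
Proof. by case=> i []; rewrite ltxx. Qed.

Lemma lexlt_trans n (a b c : 'rV[int]_n) : lexlt a b -> lexlt b c -> lexlt a c.
Proof.
move=> [i [ab eab]] [j [bc ebc]]; case: (ltngtP i j) => [ij|ji|/val_inj ij].
- by exists i; split=> [|k ki]; [rewrite -ebc|rewrite eab// ebc// (ltn_trans ki)].
- by exists j; split=> [|k kj]; [rewrite eab|rewrite eab ?ebc// (ltn_trans kj)].
- by subst j; exists i; split=> [|k ki]; [exact: lt_trans bc|rewrite eab// ebc].
Qed.

Lemma lexlt_addr n (c a b : 'rV[int]_n) : lexlt a b -> lexlt (a + c) (b + c).
Proof.
move=> [i [ab eab]]; exists i; rewrite !mxE ltrD2r; split=> // j ji.
by rewrite !mxE eab.
Qed.

Lemma lexlt_max n (s : seq 'rV[int]_n) : s != [::] ->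
  exists2 m, m \in s & forall b, b \in s -> b <> m -> lexlt b m.
Proof.
elim: s => // a [|b s] IH _.
  by exists a; rewrite ?mem_head// => b; rewrite inE => /eqP ->.
have [//|m ms mmax] := IH; case: (pselect (a = m)) => [am|am].
  exists a; rewrite ?mem_head// => c; rewrite inE => /predU1P[->//|cs] ca.
  by rewrite am; apply: mmax => //; rewrite -am.
case: (lexlt_total am) => [lam|lma].
  by exists m => [|c]; rewrite inE ?ms ?orbT// => /predU1P[->//|cs /mmax]; exact.
exists a => [|c]; rewrite ?mem_head// inE => /predU1P[->//|cs _].
by case: (pselect (c = m)) => [->//|cm]; apply: lexlt_trans lma; exact: mmax.
Qed.

Lemma laurent_lead (F : fieldType) n (p : laurent F n) : p != 0 ->
  exists2 m, p m != 0 & forall b, p b != 0 -> b <> m -> lexlt b m.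
Proof.
move=> p0; case: (@lexlt_max _ (fset_set [set b | p b != 0])) => [|m].
  apply: contra p0 => /eqP s0; apply/eqP/laurentP => b; rewrite lcoef0.
  apply/eqP; apply: contraT; rewrite -mem_lsupp => bs.
  have : b \in enum_fset (fset_set [set b | p b != 0]) by [].
  by rewrite s0.
by rewrite mem_lsupp => pm mmax; exists m => // b; rewrite -mem_lsupp; exact: mmax.
Qed.

Lemma laurent_integral (F : fieldType) n : GRing.integral_domain_axiom (laurent F n).
Proof.
move=> p q pq0; apply/norP => -[/laurent_lead[m pm mmax] /laurent_lead[k qk kmax]].
have : (p * q) (m + k) = p m * q k.
  rewrite [LHS](@conv_seq _ _ _ _ _ [:: m]) //.
  - by rewrite big_seq1 [m + k]addrC addrK.
  - exact: lcoef_finite.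
  move=> b; rewrite mulf_eq0 negb_or inE => /andP[pb qb]; apply/eqP.
  apply: contrapT => bm; have lbm := mmax _ pb bm.
  case: (pselect (m + k - b = k)) => [e|/(kmax _ qb) lt].
    by apply: bm; apply/eqP; rewrite eq_sym -subr_eq0 -(inj_eq (addIr k)) add0r addrAC e.
  have := lexlt_addr b lt; rewrite subrK => lt1.
  have := lexlt_addr k lbm; rewrite [b + k]addrC => lt2.
  exact: lexlt_irr (lexlt_trans lt1 lt2).
rewrite pq0 lcoef0 => /esym/eqP.
by rewrite mulf_eq0 (negbTE pm) (negbTE qk).
Qed.

Definition lunit (F : fieldType) n : pred (laurent F n) :=
  fun p => `[< exists q, q * p = 1 >].

Definition linv (F : fieldType) n (p : laurent F n) : laurent F n :=
  xget p [set q | q * p = 1].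

Lemma lmulVr (F : fieldType) n : {in @lunit F n, left_inverse 1 (@linv F n) *%R}.
Proof. by move=> p /asboolP ex; exact: (@xgetPex _ p [set q | q * p = 1]). Qed.

Lemma lunitPl (F : fieldType) n (p q : laurent F n) : q * p = 1 -> p \in @lunit F n.
Proof. by move=> qp; apply/asboolP; exists q. Qed.

Lemma linv_out (F : fieldType) n : {in [predC @lunit F n], @linv F n =1 id}.
Proof.
move=> p /negP nu; rewrite /linv; case: xgetP => // q qE qp.
by case: nu; exact: lunitPl qp.
Qed.

HB.instance Definition _ (F : fieldType) (n : nat) :=
  GRing.ComNzRing_hasMulInverse.Build (laurent F n)
    (@lmulVr F n) (@lunitPl F n) (@linv_out F n).
HB.instance Definition _ (F : fieldType) (n : nat) :=
  GRing.ComUnitRing_isIntegral.Build (laurent F n) (@laurent_integral F n).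

(** * Rational functions represented by Laurent series *)

(* The element q / p of Q(P), for any p, q in P with p != 0 and p . f = q;
   0 by convention if there are no such p, q. *)
Definition ratfun (F : fieldType) (n : nat) (f : 'rV[int]_n -> F) :
    {fraction laurent F n} :=
  let pq := xget (1, 0) [set pq : laurent F n * laurent F n |
                          pq.1 != 0 /\ conv pq.1 f = pq.2] in
  tofrac pq.2 / tofrac pq.1.

Lemma ratfunE (F : fieldType) n (p q : laurent F n) (f : 'rV[int]_n -> F) :
  p != 0 -> conv p f = q -> ratfun f = tofrac q / tofrac p.
Proof.
move=> p0 pfq; rewrite /ratfun; case: xgetP => [[p' q'] _ /= [p'0 pfq']|none].
  have cross : q' * p = q * p'.
    rewrite mulrC [RHS]mulrC; apply/val_inj; rewrite /= -pfq -pfq' -!conv_assoc.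
    by congr (conv (lcoef _) f); exact: lmulC.
  by apply/eqP; rewrite eqr_div ?tofrac_eq0// -!tofracM cross.
by case: (none (p, q)).
Qed.

(** * Cones and fans *)

(* M = Z^n as row vectors, N = Hom(M, Z) as column vectors, and similarly for
   M_R and N_R; the evaluation pairing is the matrix product. *)
Definition pairing (R : realType) (n : nat) (x : 'rV[R]_n) (y : 'cV[R]_n) : R :=
  (x *m y) 0 0.

Definition toR (R : realType) (n : nat) (a : 'rV[int]_n) : 'rV[R]_n :=
  map_mx intr a.

Definition dual_cone (R : realType) (n : nat) (s : set 'cV[R]_n) :
    set 'rV[R]_n :=
  [set x | forall y, s y -> 0 <= pairing x y].

Definition rational_cone (R : realType) (n : nat) (s : set 'cV[R]_n) : Prop :=
  exists (k : nat) (G : 'M[int]_(n, k)),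
    s = [set map_mx intr G *m l | l in [set l : 'cV[R]_k | forall i, 0 <= l i 0]].

Definition strongly_convex (R : realType) (n : nat) (s : set 'cV[R]_n) : Prop :=
  forall y, s y -> s (- y) -> y = 0.

Definition face (R : realType) (n : nat) (t s : set 'cV[R]_n) : Prop :=
  exists x, dual_cone s x /\ t = s `&` [set y | pairing x y = 0].

Definition is_fan (R : realType) (n : nat) (Sigma : {fset set 'cV[R]_n}) : Prop :=
  [/\ forall s, s \in Sigma -> rational_cone s /\ strongly_convex s,
      forall s t, s \in Sigma -> face t s -> t \in Sigma
    & forall s t, s \in Sigma -> t \in Sigma ->
        face (s `&` t) s /\ face (s `&` t) t].

Definition complete_fan (R : realType) (n : nat) (Sigma : {fset set 'cV[R]_n}) :
    Prop :=
  forall y, exists2 s, s \in Sigma & s y.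

Definition lin_span (R : realType) (n : nat) (s : set 'cV[R]_n) :
    {vspace 'cV[R]_n} :=
  xget 0%VS [set V : {vspace 'cV[R]_n} |
    (forall y, s y -> y \in V) /\
    forall W : {vspace 'cV[R]_n}, (forall y, s y -> y \in W) -> (V <= W)%VS].

Definition cone_dim (R : realType) (n : nat) (s : set 'cV[R]_n) : nat :=
  \dim (lin_span s).

Lemma lin_spanP (R : realType) (n : nat) (s : set 'cV[R]_n) :
  (forall y, s y -> y \in lin_span s) /\
  forall W : {vspace 'cV[R]_n}, (forall y, s y -> y \in W) ->
    (lin_span s <= W)%VS.
Proof.
apply: (@xgetPex _ 0%VS [set V : {vspace 'cV[R]_n} | (forall y, s y -> y \in V)
  /\ forall W : {vspace 'cV[R]_n}, (forall y, s y -> y \in W) -> (V <= W)%VS]).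
pose inner d := `[< exists X : seq 'cV[R]_n,
  (forall y, y \in X -> s y) /\ \dim <<X>>%VS = d >].
have ex0 : exists d, inner d.
  by exists 0%N; apply/asboolP; exists [::]; rewrite span_nil dimv0.
have ub d : inner d -> (d <= \dim {:'cV[R]_n})%N.
  by move=> /asboolP[X [_ <-]]; exact/dimvS/subvf.
case: (ex_maxnP ex0 ub) => d /asboolP[X [Xs dX]] dmax.
exists <<X>>%VS; split=> [y sy|W sW]; last first.
  by apply/span_subvP => y /Xs /sW.
have Xy : (<<X>> <= <<y :: X>>)%VS by apply: sub_span => z; rewrite inE orbC => ->.
have : (\dim <<y :: X>> <= \dim <<X>>)%N.
  rewrite dX; apply: dmax; apply/asboolP; exists (y :: X); split=> // z.
  by rewrite inE => /predU1P[->|/Xs].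
rewrite (geq_leqif (dimv_leqif_sup Xy)) => /subvP; apply.
by apply: memv_span; rewrite mem_head.
Qed.

(** * Support functions and the rational function R(Sigma, h) *)

(* The linear forms m s = h_s are part of the data, since they are determined by
   h only up to linear forms vanishing on s. *)
Definition support_function (R : realType) (n : nat)
    (Sigma : {fset set 'cV[R]_n}) (h : 'cV[R]_n -> R)
    (m : set 'cV[R]_n -> 'rV[int]_n) : Prop :=
  forall s, s \in Sigma -> forall y, s y -> h y = pairing (toR R (m s)) y.

(* R[K] *)
Definition lattice_series (R : realType) (n : nat) (K : set 'rV[R]_n) :
    'rV[int]_n -> R[i] :=
  fun a => (toR R a \in K)%:R.

Definition fan_ratfun (R : realType) (n : nat) (Sigma : {fset set 'cV[R]_n})
    (m : set 'cV[R]_n -> 'rV[int]_n) : {fraction laurent R[i] n} :=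
  \sum_(s <- Sigma | cone_dim s == n)
    ratfun (lattice_series [set toR R (- m s) + x | x in dual_cone s]).

(** * The line bundle L_h *)

(* C[M `&` s^vee] *)
Definition chart_ring (R : realType) (n : nat) (s : set 'cV[R]_n) :
    set (laurent R[i] n) :=
  [set g | forall a, g a != 0 -> dual_cone s (toR R a)].

(* The sections of L_h over U_s, where m = h_s. *)
Definition sections (R : realType) (n : nat) (m : 'rV[int]_n)
    (s : set 'cV[R]_n) : set (laurent R[i] n) :=
  [set g * lmonom R[i] (- m) | g in chart_ring s].

Lemma lmonom_sections (R : realType) (n : nat) (m b : 'rV[int]_n)
    (s : set 'cV[R]_n) :
  sections m s (lmonom R[i] b) <-> dual_cone s (toR R (b + m)).
Proof.
split=> [[g gs gE]|sbm].
  apply: gs; have := congr1 (fun p : laurent _ _ => p b) gE.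
  rewrite mulrC /= conv_monom opprK eqxx => ->; exact: oner_neq0.
exists (lmonom R[i] (b + m)) => [a /=|].
  by case: (a =P b + m) => [->//|_]; rewrite eqxx.
apply: laurentP => a; rewrite mulrC /= conv_monom opprK.
by rewrite (inj_eq (addIr m)).
Qed.

(** * Orientations and incidence numbers of cells *)

(* Determinant of the family B' in the basis B (of the span of B). *)
Definition basis_det (R : realType) (n : nat) (B B' : seq 'cV[R]_n) : R :=
  \det (\matrix_(i < size B, j < size B) coord (in_tuple B) i B'`_j).

(* The cell of a cone s is oriented by an ordered basis o s of the span of s.
   A codimension one face t of s gets [s : t] = 1 or -1 according to whether the
   orientation of s agrees with that of t preceded by a vector of s outside t.
   Putting an inward instead of an outward vector first amounts to changing the
   orientation of all the cells of certain dimensions. *)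
Definition incidence (R : realType) (n : nat)
    (o : set 'cV[R]_n -> seq 'cV[R]_n) (s t : set 'cV[R]_n) : int :=
  if `[< face t s >] && (cone_dim s == (cone_dim t).+1)
  then sgz (basis_det (o s) (xget 0 (s `\` t) :: o t)) else 0.

Definition orientation (R : realType) (n : nat) (Sigma : {fset set 'cV[R]_n})
    (o : set 'cV[R]_n -> seq 'cV[R]_n) : Prop :=
  (forall s, s \in Sigma -> basis_of (lin_span s) (o s)) /\
  (forall s, s \in Sigma -> cone_dim s = 1%N -> incidence o s [set 0] = 1).

(** * The cochain complex of L_h and its cohomology, in degree b in M *)

(* The cones of codimension k over which L_h has a section of degree b. *)
Definition cell (R : realType) (n : nat) (Sigma : {fset set 'cV[R]_n})
    (m : set 'cV[R]_n -> 'rV[int]_n) (b : 'rV[int]_n) (k : nat) : finType :=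
  {s : Sigma | (cone_dim (val s) + k == n)%N
               && (lmonom R[i] b \in sections (m (val s)) (val s))}.

Definition cochain (R : realType) (n : nat) (Sigma : {fset set 'cV[R]_n})
    (m : set 'cV[R]_n -> 'rV[int]_n) (b : 'rV[int]_n) (k : nat) :
    vectType R[i] :=
  {ffun cell Sigma m b k -> R[i]^o}.

Definition differential (R : realType) (n : nat) (Sigma : {fset set 'cV[R]_n})
    (m : set 'cV[R]_n -> 'rV[int]_n) (o : set 'cV[R]_n -> seq 'cV[R]_n)
    (b : 'rV[int]_n) (k : nat) (w : cochain Sigma m b k) :
    cochain Sigma m b k.+1 :=
  [ffun t => \sum_s (incidence o (val (val s)) (val (val t)))%:~R * w s].

Lemma differential_linear (R : realType) (n : nat)
    (Sigma : {fset set 'cV[R]_n}) (m : set 'cV[R]_n -> 'rV[int]_n)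
    (o : set 'cV[R]_n -> seq 'cV[R]_n) (b : 'rV[int]_n) (k : nat) :
  linear (@differential R n Sigma m o b k).
Proof.
move=> c v w; apply/ffunP => t; rewrite !ffunE scaler_sumr -big_split /=.
by apply: eq_bigr => s _; rewrite !ffunE mulrDr -scalerAr.
Qed.

HB.instance Definition _ (R : realType) (n : nat)
    (Sigma : {fset set 'cV[R]_n}) (m : set 'cV[R]_n -> 'rV[int]_n)
    (o : set 'cV[R]_n -> seq 'cV[R]_n) (b : 'rV[int]_n) (k : nat) :=
  GRing.isLinear.Build R[i] (cochain Sigma m b k) (cochain Sigma m b k.+1) _
    (@differential R n Sigma m o b k) (@differential_linear R n Sigma m o b k).

Definition cocycles (R : realType) (n : nat) (Sigma : {fset set 'cV[R]_n})
    (m : set 'cV[R]_n -> 'rV[int]_n) (o : set 'cV[R]_n -> seq 'cV[R]_n)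
    (b : 'rV[int]_n) (k : nat) : {vspace cochain Sigma m b k} :=
  lker (linfun (@differential R n Sigma m o b k)).

Definition coboundaries (R : realType) (n : nat) (Sigma : {fset set 'cV[R]_n})
    (m : set 'cV[R]_n -> 'rV[int]_n) (o : set 'cV[R]_n -> seq 'cV[R]_n)
    (b : 'rV[int]_n) (k : nat) : {vspace cochain Sigma m b k} :=
  match k with
  | 0 => 0%VS
  | k'.+1 => limg (linfun (@differential R n Sigma m o b k'))
  end.

(* dim H^k(X_Sigma; L_h)_b = dim (Z^k / B^k); the subtraction is not truncated,
   since coboundaries are cocycles. *)
Definition cohomology_dim (R : realType) (n : nat)
    (Sigma : {fset set 'cV[R]_n}) (m : set 'cV[R]_n -> 'rV[int]_n)
    (o : set 'cV[R]_n -> seq 'cV[R]_n) (b : 'rV[int]_n) (k : nat) : nat :=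
  \dim (cocycles Sigma m o b k) - \dim (coboundaries Sigma m o b k).

Definition euler_char (R : realType) (n : nat) (Sigma : {fset set 'cV[R]_n})
    (m : set 'cV[R]_n -> 'rV[int]_n) (o : set 'cV[R]_n -> seq 'cV[R]_n)
    (b : 'rV[int]_n) : int :=
  \sum_(k < n.+1) (-1) ^+ k * (cohomology_dim Sigma m o b k)%:Z.

(* Main.v *)
Require Import Defs.
From HB Require Import structures.
From mathcomp Require Import all_boot all_order all_algebra fraction complex.
From mathcomp Require Import perm finmap.
From mathcomp Require Import all_classical reals.
From mathcomp Require Import zify ring lra.

(** Call a lattice point [a] good for a cone [s] if [a + h_s] is nonnegative on
    [s], that is, if [x^a] is a section of the line bundle over the chart of [s].
    In degree [a] the cochain complex has a basis vector in degree [n - dim s] for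
    each cone [s] for which [a] is good. It is a complex, because between cones
    whose dimensions differ by 2 there are exactly two cones, with opposite
    products of incidence numbers ([diamond]). By rank-nullity the Euler
    characteristic in degree [a] is therefore the sum of [(-1)^(n - dim s)] over
    the cones [s] for which [a] is good ([euler_char_cones]). Summed over all [a]
    this is an identity of formal series:

      the series of Euler characteristics is
      the sum over all [s] of [(-1)^(n - dim s) R[- h_s + s^vee]].

    Each series on the right becomes a Laurent polynomial after multiplication by
    a nonzero Laurent polynomial ([section_series_summable]), so it represents a
    rational function, and this is additive. If [dim s < n], the dual of [s]
    contains a line, a nonzero [1 - x^l] kills the series, and it represents 0
    ([section_series_lowdim]). What remains on the right is [R(Sigma, h)].

    On the left one needs that only finitely many [a] have a nonzero Euler
    characteristic ([signed_count_finite]); this elementary fact takes the place of the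
    finiteness of the cohomology of a complete variety. The Euler characteristic
    in degree [a] depends only on the signs of finitely many affine functions of
    [a]. If it were nonzero for infinitely many [a], there would be such an [a]
    and a direction [u <> 0] for which these signs are constant on the ray
    [a + t u], [t >= 0] ([escape]). For large [t] the piecewise linear function
    [g = h + a + t u] has slope at least 1 in some direction [y0] with
    [u y0 = 1], so that [y |-> y + (g y - u y) y0] is a piecewise linear bijection
    which transforms [g] into [u]. It turns the relative interiors of the cones
    into another partition of the space into open cones of the same dimensions.
    The Euler characteristic becomes, up to sign, the Euler characteristic with
    compact support of the half-space [u >= 0], which is 0 ([euler_halfspace],
    [fan_euler_vanish]): a contradiction. *)

Set Implicit Arguments.
Unset Strict Implicit.
Unset Printing Implicit Defensive.

Import Order.TTheory GRing.Theory Num.Theory.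

Local Open Scope classical_set_scope.
Local Open Scope ring_scope.

(** * Rational polyhedral cones: generators and inequalities *)

Lemma mem_tail (T : eqType) (x y : T) s : x \in s -> x \in y :: s.
Proof. by rewrite inE orbC => ->. Qed.

Section Pairing.
Context {R : realType} {n : nat}.
Implicit Types (x : 'rV[R]_n) (y : 'cV[R]_n).

Lemma pairingDl x x' y : pairing (x + x') y = pairing x y + pairing x' y.
Proof. by rewrite /pairing mulmxDl mxE. Qed.
Lemma pairingDr x y y' : pairing x (y + y') = pairing x y + pairing x y'.
Proof. by rewrite /pairing mulmxDr mxE. Qed.
Lemma pairingNl x y : pairing (- x) y = - pairing x y.
Proof. by rewrite /pairing mulNmx mxE. Qed.
Lemma pairingNr x y : pairing x (- y) = - pairing x y.
Proof. by rewrite /pairing mulmxN mxE. Qed.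
Lemma pairingZl c x y : pairing (c *: x) y = c * pairing x y.
Proof. by rewrite /pairing -scalemxAl mxE. Qed.
Lemma pairingZr c x y : pairing x (c *: y) = c * pairing x y.
Proof. by rewrite /pairing -scalemxAr mxE. Qed.
Lemma pairing0l y : pairing 0 y = 0.
Proof. by rewrite /pairing mul0mx mxE. Qed.
Lemma pairing0r x : pairing x 0 = 0.
Proof. by rewrite /pairing mulmx0 mxE. Qed.
Definition pairingE := (pairingDl, pairingDr, pairingNl, pairingNr, pairingZl,
  pairingZr, pairing0l, pairing0r).

Lemma pairing_tr x y : pairing x y = pairing y^T x^T.
Proof. by rewrite /pairing -trmx_mul [RHS]mxE. Qed.

Lemma pairing_eq0 x : (forall y, pairing x y = 0) -> x = 0.
Proof.
move=> x0; apply/rowP => i; have := x0 (delta_mx i 0).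
by rewrite /pairing -colE !mxE.
Qed.

End Pairing.

Definition idot n (a : 'rV[int]_n) (b : 'cV[int]_n) : int := (a *m b) 0 0.

Notation toC R v := (map_mx (intr : int -> R) v).

Lemma pairing_int (R : realType) n (a : 'rV[int]_n) (b : 'cV[int]_n) :
  pairing (toR R a) (toC R b) = (idot a b)%:~R.
Proof. by rewrite /pairing /toR -map_mxM mxE. Qed.

Lemma toRD (R : realType) n (a b : 'rV[int]_n) : toR R (a + b) = toR R a + toR R b.
Proof. exact: map_mxD. Qed.
Lemma toRN (R : realType) n (a : 'rV[int]_n) : toR R (- a) = - toR R a.
Proof. exact: map_mxN. Qed.
Lemma toR_inj (R : realType) n : injective (@toR R n).
Proof.
by move=> a b /rowP ab; apply/rowP => i; have := ab i; rewrite !mxE => /intr_inj.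
Qed.

(** The nonnegative combinations of [vs]. The recursive form makes membership of
    [y] in the cone over [v :: vs] read: the ray from [y] in direction [- v]
    meets the cone over [vs]; this is what elimination of a variable needs. *)
Fixpoint incone (R : realType) n (vs : seq 'cV[int]_n) (y : 'cV[R]_n) : Prop :=
  if vs is v :: vs' then exists c, 0 <= c /\ incone vs' (y - c *: toC R v)
  else y = 0.

Section Cones.
Context {R : realType} {n : nat}.
Implicit Types (x : 'rV[R]_n) (y : 'cV[R]_n) (vs : seq 'cV[int]_n).

Lemma incone_ge0 vs y x : incone vs y ->
  (forall v, v \in vs -> 0 <= pairing x (toC R v)) -> 0 <= pairing x y.
Proof.
elim: vs y => [y /= -> _|v vs IH y /= [c [c0 /IH yc]] xv]; first by rewrite pairing0r.
have := yc (fun w wvs => xv w (mem_tail _ wvs)).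
rewrite !pairingE subr_ge0; apply: le_trans; apply: mulr_ge0 => //.
by apply: xv; rewrite mem_head.
Qed.

Lemma incone0 vs : incone vs (0 : 'cV[R]_n).
Proof. by elim: vs => //= v vs IH; exists 0; rewrite scale0r subr0. Qed.

Lemma incone_gen vs v : v \in vs -> incone vs (toC R v).
Proof.
elim: vs => //= w vs IH; rewrite inE => /predU1P[->|/IH vvs].
  by exists 1; rewrite scale1r subrr; split; [|exact: incone0].
by exists 0; rewrite scale0r subr0.
Qed.

Lemma incone_map (I : eqType) (r : seq I) (F : I -> 'cV[int]_n) y : uniq r ->
  incone [seq F i | i <- r] y <->
  exists2 l : I -> R, forall i, 0 <= l i & y = \sum_(i <- r) l i *: toC R (F i).
Proof.
elim: r y => [|i r IH] y /=.
  split=> [->|[l _ ->]]; last by rewrite big_nil.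
  by exists (fun=> 0); rewrite ?big_nil.
case/andP=> ir /IH {}IH; split=> [[c [c0 /IH[l l0 ylc]]]|[l l0 ->]].
  exists (fun j => if j == i then c else l j) => [j|]; first by case: ifP.
  rewrite big_cons eqxx -[LHS](subrK (c *: toC R (F i))) ylc addrC; congr (_ + _).
  rewrite !big_seq; apply: eq_bigr => j jr.
  by case: eqP => // ji; rewrite ji (negbTE ir) in jr.
by exists (l i); split=> //; apply/IH; exists l => //; rewrite big_cons addrC addKr.
Qed.

(** Any generator that has a nonzero share in [y] works: if a form is nonnegative
    on all generators and vanishes at [y], it vanishes on each summand of [y]. *)
Lemma incone_support vs y : incone vs y -> y != 0 ->
  exists v, [/\ v \in vs, v != 0 & forall x : 'rV[R]_n,
    (forall w, w \in vs -> 0 <= pairing x (toC R w)) -> pairing x y = 0 ->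
    pairing x (toC R v) = 0].
Proof.
elim: vs y => [y /= -> /eqP//|v vs IH y /= [c [c0 yc]] y0].
have [cv0|cv0] := eqVneq (c *: toC R v) 0.
  move: yc; rewrite cv0 subr0 => /IH /(_ y0)[w [wvs w0 wP]].
  exists w; split; rewrite ?inE ?wvs ?orbT// => x xvs; apply: wP => z zvs.
  by apply: xvs; rewrite inE zvs orbT.
exists v; split; first by rewrite mem_head.
  by apply: contra cv0 => /eqP ->; rewrite map_mx0 scaler0.
move=> x xvs xy; have := incone_ge0 yc (fun w wvs => xvs w (mem_tail _ wvs)).
rewrite !pairingE xy sub0r oppr_ge0 => le0.
have c_gt0 : 0 < c.
  by rewrite lt_def c0 andbT; apply: contra cv0 => /eqP ->; rewrite scale0r.
apply/eqP; rewrite eq_le xvs ?mem_head// andbT.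
by rewrite -(pmulr_rle0 _ c_gt0).
Qed.

(** Fourier-Motzkin elimination of [c >= 0] from the system [0 <= l (y - c v)]:
    every lower bound on [c], from a form that is negative at [v], is combined
    with every upper bound, from a form that is positive at [v]; the bound
    [0 <= c] together with the upper bounds leaves the forms themselves. The
    coefficients stay integers. *)
Definition eliminate (v : 'cV[int]_n) (L : seq 'rV[int]_n) : seq 'rV[int]_n :=
  [seq l <- L | 0 <= idot l v] ++
  [seq idot lp v *: ln - idot ln v *: lp |
     ln <- [seq l <- L | idot l v < 0], lp <- [seq l <- L | 0 < idot l v]].

Lemma toRZ (c : int) (a : 'rV[int]_n) : toR R (c *: a) = c%:~R *: toR R a.
Proof. by apply/rowP => i; rewrite !mxE intrM. Qed.

Lemma max_lower_bound (S : seq R) :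
  exists c, 0 <= c /\ (forall z, z \in S -> z <= c) /\ (c = 0 \/ c \in S).
Proof.
elim: S => [|z S [c [c0 [cS cE]]]]; first by exists 0; split=> //; split=> //; left.
have [zc|cz] := leP z c.
  exists c; split=> //; split=> [w|]; first by rewrite inE => /predU1P[->//|/cS].
  by case: cE => [->|cS']; [left|right; rewrite inE cS' orbT].
exists z; split; [lra|split=> [w|]]; last by right; rewrite mem_head.
by rewrite inE => /predU1P[->//|/cS]; lra.
Qed.

(** The largest of the lower bounds on [c] is a solution as soon as it is below
    all the upper bounds. *)
Lemma eliminateP (v : 'cV[int]_n) (L : seq 'rV[int]_n) y :
  (forall l, l \in eliminate v L -> 0 <= pairing (toR R l) y) <->
  exists c, 0 <= c /\ forall l, l \in L -> 0 <= pairing (toR R l) (y - c *: toC R v).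
Proof.
split=> [elL|[c [c0 cL]] l].
  pose S := [seq pairing (toR R l) y / (idot l v)%:~R | l <- L & idot l v < 0].
  have [c [c0 [cS cE]]] := max_lower_bound S.
  exists c; split=> // l lL; rewrite pairingDr pairingNr pairingZr pairing_int.
  have pos (k : 'rV[int]_n) : k \in L -> 0 <= idot k v -> 0 <= pairing (toR R k) y.
    by move=> kL kv; apply: elL; rewrite mem_cat mem_filter kv kL.
  have [lv|lv|lv] := ltgtP (idot l v) 0.
  - have : pairing (toR R l) y / (idot l v)%:~R <= c.
      by apply: cS; apply/mapP; exists l => //; rewrite mem_filter lv.
    have lvR : (idot l v)%:~R < 0 :> R by rewrite ltrz0.
    by rewrite ler_ndivrMr// subr_ge0.
  - case: cE => [->|/mapP[k]].
      by rewrite mul0r subr0 pos// ltW.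
    rewrite mem_filter => /andP[kv kL] ->.
    have : 0 <= pairing (toR R (idot l v *: k - idot k v *: l)) y.
      apply: elL; rewrite mem_cat; apply/orP; right; apply/allpairsP.
      by exists (k, l); rewrite /= !mem_filter kv lv.
    rewrite toRD toRN !toRZ !pairingE.
    have kvR : (idot k v)%:~R < 0 :> R by rewrite ltrz0.
    have kE : pairing (toR R k) y =
        pairing (toR R k) y / (idot k v)%:~R * (idot k v)%:~R.
      by rewrite divfK// lt_eqF.
    rewrite {1}kE mulrCA [_ * pairing (toR R l) y]mulrC [X in X - _]mulrC mulrAC -mulrBl.
    by rewrite nmulr_lge0// mulrC subr_le0 subr_ge0.
  - by rewrite lv mulr0 subr0 pos// lv.
rewrite mem_cat => /orP[|/allpairsP[[k p] /=]].
  rewrite mem_filter => /andP[lv /cL].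
  rewrite !pairingE pairing_int subr_ge0; apply: le_trans.
  by rewrite mulr_ge0// ler0z.
rewrite !mem_filter => -[/andP[kv /cL kL] /andP[pv /cL pL] ->].
move: kL pL; rewrite toRD toRN !toRZ !pairingE !pairing_int.
have kvR : (idot k v)%:~R < 0 :> R by rewrite ltrz0.
have pvR : 0 < (idot p v)%:~R :> R by rewrite ltr0z.
move: (pairing _ _) (pairing _ _) => P Q.
move: ((idot p v)%:~R) ((idot k v)%:~R : R) pvR kvR => A B A0 B0 H1 H2.
nra.
Qed.

(** Cones generated by lattice vectors are cut out by lattice forms: one
    elimination for each generator, starting from the cone [{0}]. *)
Lemma weyl vs : exists L : seq 'rV[int]_n,
  forall y : 'cV[R]_n, incone vs y <-> forall l, l \in L -> 0 <= pairing (toR R l) y.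
Proof.
elim: vs => [|v vs [L LP]].
  exists ([seq delta_mx 0 i | i <- enum 'I_n] ++ [seq - delta_mx 0 i | i <- enum 'I_n]).
  have pd (i : 'I_n) y : pairing (toR R (delta_mx 0 i)) y = y i 0.
    by rewrite /pairing /toR map_delta_mx -rowE mxE.
  move=> y; split=> [-> l _|Ly]; first by rewrite pairing0r.
  apply/colP => i; apply/eqP; rewrite mxE eq_le -oppr_ge0 -pd -pairingNl -toRN.
  by rewrite !Ly// mem_cat; apply/orP; [left|right]; apply/mapP; exists i; rewrite ?mem_enum.
exists (eliminate v L) => y; rewrite eliminateP /=.
by split=> -[c [c0 /LP yc]]; exists c.
Qed.

Lemma rational_coneP (s : set 'cV[R]_n) : rational_cone s ->
  exists (vs : seq 'cV[int]_n) (L : seq 'rV[int]_n),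
    (forall y, s y <-> incone vs y) /\
    (forall y, s y <-> forall l, l \in L -> 0 <= pairing (toR R l) y).
Proof.
move=> [k [G sG]]; pose vs := [seq col i G | i <- enum 'I_k].
have svs y : s y <-> incone vs y.
  have GE (l : 'cV[R]_k) : toC R G *m l = \sum_(i <- enum 'I_k) l i 0 *: toC R (col i G).
    apply/colP => i; rewrite mxE summxE big_enum; apply: eq_bigr => j _.
    by rewrite !mxE mulrC.
  rewrite incone_map ?enum_uniq// sG; split=> [[l l0 <-]|[l l0 ->]].
    by exists (l^~ 0).
  exists (\col_i l i) => [i|]; first by rewrite mxE.
  by rewrite GE; apply: eq_bigr => i _; rewrite mxE.
have [L LP] := weyl vs; exists vs, L; split=> // y.
by rewrite svs.
Qed.

Lemma dual_coneP (s : set 'cV[R]_n) (vs : seq 'cV[int]_n) :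
  (forall y, s y <-> incone vs y) ->
  forall x, dual_cone s x <-> forall v, v \in vs -> 0 <= pairing x (toC R v).
Proof.
move=> svs x; split=> [sx v vvs|xvs y /svs/incone_ge0]; last exact.
by apply/sx/svs/incone_gen.
Qed.

(** Biduality. A form [b] that is nonnegative on the rows of [L] is, read as a
    vector, a point of [s]; so [x] is nonnegative on it, and [x] satisfies the
    inequalities that cut out the cone over [L]. *)
Lemma farkas (s : set 'cV[R]_n) (L : seq 'rV[int]_n) :
  (forall y, s y <-> forall l, l \in L -> 0 <= pairing (toR R l) y) ->
  forall x, dual_cone s x -> incone [seq l^T | l <- L] x^T.
Proof.
move=> sL x sx; have [B BP] := weyl [seq l^T | l <- L].
apply/BP => b bB; rewrite pairing_tr trmxK; apply: sx; apply/sL => l lL.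
rewrite pairing_tr trmxK /toR map_trmx.
by apply: (BP _).1 => //; apply: incone_gen; apply/mapP; exists l.
Qed.

End Cones.

(** * Euler characteristic of open cones *)

Section Euler.
Context {R : realType} {n : nat}.
Implicit Types (x l : 'rV[R]_n) (y : 'cV[R]_n) (S T s : set 'cV[R]_n).

Lemma sub_lin_span S y : S y -> y \in lin_span S.
Proof. exact: (lin_spanP S).1. Qed.

Lemma lin_span_min S (W : {vspace 'cV[R]_n}) :
  (forall y, S y -> y \in W) -> (lin_span S <= W)%VS.
Proof. exact: (lin_spanP S).2. Qed.

Lemma lin_span_sub S T : S `<=` T -> (lin_span S <= lin_span T)%VS.
Proof. by move=> ST; apply: lin_span_min => y /ST/sub_lin_span. Qed.

Definition lform l : 'cV[R]_n -> R^o := fun y => pairing l y.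

Lemma lform_linear l : linear (lform l).
Proof. by move=> c y z; rewrite /lform pairingDr pairingZr. Qed.
HB.instance Definition _ l :=
  GRing.isLinear.Build R 'cV[R]_n R^o _ (lform l) (lform_linear l).

Definition hyperplane l : {vspace 'cV[R]_n} := lker (linfun (lform l)).

Lemma mem_hyperplane l y : (y \in hyperplane l) = (pairing l y == 0).
Proof. by rewrite memv_ker lfunE. Qed.

Lemma lin_span_ker S l : (forall y, S y -> pairing l y = 0) ->
  forall y, y \in lin_span S -> pairing l y = 0.
Proof.
move=> Sl y; have /subvP sub : (lin_span S <= hyperplane l)%VS.
  by apply: lin_span_min => z /Sl lz; rewrite mem_hyperplane lz.
by move=> /sub; rewrite mem_hyperplane => /eqP.
Qed.

Lemma dim_hyperplane (V : {vspace 'cV[R]_n}) l v : v \in V -> pairing l v != 0 ->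
  (\dim (V :&: hyperplane l)).+1 = \dim V.
Proof.
move=> vV lv; rewrite -(limg_ker_dim (linfun (lform l)) V) -addn1; congr (_ + _)%N.
apply/esym/eqP; rewrite eqn_leq; apply/andP; split.
  by apply: leq_trans (dimvS (subvf _)) _; rewrite dimvf.
rewrite lt0n dimv_eq0; apply: contraNneq lv => V0.
have : linfun (lform l) v \in (linfun (lform l) @: V)%VS by rewrite memv_img.
by rewrite V0 memv0 lfunE.
Qed.

(** Openness is relative to the linear span. Such a set need not contain 0, and it
    may be empty. *)
Definition open_cone S : Prop :=
  (forall y z a b, 0 < a -> 0 < b -> S y -> S z -> S (a *: y + b *: z)) /\
  (forall y v, S y -> v \in lin_span S ->
     exists2 e, 0 < e & forall t, 0 < t -> t <= e -> S (y + t *: v)).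

(** The Euler characteristic with compact support of an open cone, which is a cell
    of dimension [cone_dim S] unless it is empty. *)
Definition euler_weight S : int :=
  if `[< exists y, S y >] then (-1) ^+ cone_dim S else 0.

Definition sign_part l (e : R) S : set 'cV[R]_n :=
  S `&` [set y | Num.sg (pairing l y) = e].

Lemma open_coneI S T : open_cone S -> open_cone T -> open_cone (S `&` T).
Proof.
move=> [Sc So] [Tc To]; split=> [y z a b a0 b0 [Sy Ty] [Sz Tz]|y v [Sy Ty] vST].
  by split; [exact: Sc|exact: Tc].
have [|e e0 Se] := So y v Sy.
  by move/subvP: (@lin_span_sub (S `&` T) S (@subIsetl _ _ _)); exact.
have [|f f0 Tf] := To y v Ty.
  by move/subvP: (@lin_span_sub (S `&` T) T (@subIsetr _ _ _)); exact.
exists (Num.min e f) => [|t t0]; first by rewrite lt_min e0.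
by rewrite le_min => /andP[te tf]; split; [exact: Se|exact: Tf].
Qed.

Lemma sg_perturb (p q : R) : p != 0 ->
  exists2 e, 0 < e & forall t, 0 < t -> t <= e -> Num.sg (p + t * q) = Num.sg p.
Proof.
move=> p0; have p0' : 0 < `|p| by rewrite normr_gt0.
exists (`|p| / (`|q| + 1) / 2) => [|t t0 te].
  by rewrite !divr_gt0// ltr_wpDl.
have tq : `|t * q| < `|p|.
  rewrite normrM (gtr0_norm t0).
  have q1 : 0 < `|q| + 1 by rewrite ltr_wpDl.
  move: te; rewrite -mulrA -invfM mulrC ler_pdivlMl ?mulr_gt0//.
  by have := normr_ge0 q; nra.
case: (ltgtP p 0) p0 => [pn _|pp _|-> //].
  by rewrite (ltr0_sg pn) ltr0_sg//; move: tq; rewrite (ltr0_norm pn) ltr_norml; lra.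
by rewrite (gtr0_sg pp) gtr0_sg//; move: tq; rewrite (gtr0_norm pp) ltr_norml; lra.
Qed.

Lemma sg_comb (p q a b : R) : 0 < a -> 0 < b -> Num.sg p = Num.sg q ->
  Num.sg (a * p + b * q) = Num.sg p.
Proof.
move=> a0 b0; case: (ltgtP p 0) => [pn|pp|->]; case: (ltgtP q 0) => [qn|qp|->];
 rewrite ?sgr0 ?(ltr0_sg pn) ?(gtr0_sg pp) ?(ltr0_sg qn) ?(gtr0_sg qp);
 try (move=> H; exfalso; move: H; lra); move=> _.
- by rewrite ltr0_sg//; nra.
- by rewrite gtr0_sg//; nra.
- by rewrite !mulr0 addr0 sgr0.
Qed.

Lemma open_cone_sign S l e : open_cone S -> open_cone (sign_part l e S).
Proof.
move=> [Sc So]; split=> [y z a b a0 b0 [Sy /= ly] [Sz /= lz]|y v [Sy /= ly] vS].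
  split=> /=; first exact: Sc.
  by rewrite !pairingE sg_comb// ly.
have vSl : v \in lin_span S.
  by move/subvP: (@lin_span_sub (sign_part l e S) S (@subIsetl _ _ _)); exact.
have [f f0 Sf] := So y v Sy vSl.
have [l0|l0] := eqVneq (pairing l y) 0.
  exists f => // t t0 tf; split=> /=; first exact: Sf.
  rewrite !pairingE (_ : pairing l v = 0) ?mulr0 ?addr0//.
  apply: lin_span_ker vS => z [_ /=]; rewrite -ly l0 sgr0.
  by move/eqP; rewrite sgr_eq0 => /eqP.
have [g g0 lg] := sg_perturb (pairing l v) l0.
exists (Num.min f g) => [|t t0]; first by rewrite lt_min f0.
rewrite le_min => /andP[tf tg]; split=> /=; first exact: Sf.
by rewrite !pairingE lg.
Qed.

Lemma euler_weight0 S : (forall y, ~ S y) -> euler_weight S = 0.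
Proof. by move=> S0; rewrite /euler_weight asboolF// => -[y /S0]. Qed.

Lemma euler_weightE S y : S y -> euler_weight S = (-1) ^+ cone_dim S.
Proof. by move=> Sy; rewrite /euler_weight asboolT//; exists y. Qed.

(** The piece is nonempty and open in [S], so differences of its points span
    everything that [S] spans. *)
Lemma lin_span_sign S l e y : open_cone S -> e != 0 -> sign_part l e S y ->
  lin_span (sign_part l e S) = lin_span S.
Proof.
move=> [Sc So] e0 [Sy /= ly]; apply/eqP; rewrite eqEsubv lin_span_sub/=; last exact: subIsetl.
apply: lin_span_min => v Sv.
have [f f0 Sf] := So y v Sy (sub_lin_span Sv).
have l0 : pairing l y != 0 by apply: contraNneq e0 => l0; rewrite -ly l0 sgr0.
have [g g0 lg] := sg_perturb (pairing l v) l0.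
pose t := Num.min f g; have t0 : 0 < t by rewrite lt_min f0.
have yS : y \in lin_span (sign_part l e S) by apply: sub_lin_span.
have : y + t *: v \in lin_span (sign_part l e S).
  apply: sub_lin_span; split=> /=; first by apply: Sf; rewrite // ge_min lexx.
  by rewrite !pairingE lg// ge_min lexx orbT.
rewrite rpredDl// => /(memvZ t^-1).
by rewrite scalerA mulVf ?gt_eqF// scale1r.
Qed.

Lemma lin_span_sign0 S l y : open_cone S -> sign_part l 0 S y ->
  lin_span (sign_part l 0 S) = (lin_span S :&: hyperplane l)%VS.
Proof.
move=> [Sc So] [Sy /= /eqP]; rewrite sgr_eq0 => /eqP ly; apply/eqP; rewrite eqEsubv; apply/andP; split.
  apply: lin_span_min => z [Sz /= /eqP]; rewrite sgr_eq0 => lz.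
  by rewrite memv_cap sub_lin_span//= mem_hyperplane.
apply/subvP => v; rewrite memv_cap mem_hyperplane => /andP[vS /eqP lv].
have [f f0 Sf] := So y v Sy vS.
have yS : y \in lin_span (sign_part l 0 S) by apply: sub_lin_span; split=> //=; rewrite ly sgr0.
have : y + f *: v \in lin_span (sign_part l 0 S).
  by apply: sub_lin_span; split=> /=; [exact: Sf|rewrite !pairingE ly lv mulr0 addr0 sgr0].
rewrite rpredDl// => /(memvZ f^-1).
by rewrite scalerA mulVf ?gt_eqF// scale1r.
Qed.

Lemma sgr_cases (p : R) : [\/ Num.sg p = 1, Num.sg p = 0 | Num.sg p = -1].
Proof.
by case: (ltgtP p 0) => [/ltr0_sg|/gtr0_sg|->]; rewrite ?sgr0;
  [constructor 3|constructor 1|constructor 2].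
Qed.

(** Additivity. Either [l] has constant sign on [S], and two of the pieces are
    empty; or it takes both signs, hence also the value 0 by convexity, and the
    weights are [w], [- w] and [w], where the middle piece has one dimension less. *)
Lemma euler_weight_split S l : open_cone S ->
  euler_weight S = euler_weight (sign_part l 1 S) + euler_weight (sign_part l 0 S)
    + euler_weight (sign_part l (-1) S).
Proof.
move=> Sop; have [Sc So] := Sop.
(* Openness: from a zero of l in S one reaches both sides along v. *)
have both y v : sign_part l 0 S y -> S v -> pairing l v != 0 ->
    forall e, e = 1 \/ e = -1 -> exists z, sign_part l e S z.
  move=> [Sy /= /eqP]; rewrite sgr_eq0 => /eqP ly Sv lv e eE.
  have e0 : e != 0 by case: eE => ->; rewrite ?oppr_eq0 oner_eq0.
  have sge : Num.sg e = e by case: eE => ->; rewrite ?sgrN sgr1.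
  have [] := So y ((e * (pairing l v)) *: v) Sy; first by rewrite memvZ// sub_lin_span.
  move=> f f0 Sf; exists (y + f *: ((e * pairing l v) *: v)); split=> /=; first exact: Sf.
  rewrite !pairingE ly add0r !sgrM (gtr0_sg f0) mul1r sge -mulrA -expr2 sqr_sg lv.
  by rewrite mulr1.
(* Convexity: between points of opposite signs there is a zero. *)
have cross y z : sign_part l 1 S y -> sign_part l (-1) S z -> exists t, sign_part l 0 S t.
  move=> [Sy /= /eqP]; rewrite sgr_cp0 => ly [Sz /= /eqP]; rewrite sgr_cp0 => lz.
  exists (- pairing l z *: y + pairing l y *: z); split=> /=.
    by apply: Sc => //; rewrite oppr_gt0.
  by rewrite !pairingE mulNr [_ * pairing l y]mulrC addNr sgr0.
have [[y0 S0]|none] := pselect (exists y, sign_part l 0 S y).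
  (* The hyperplane meets S; it cuts S into three nonempty pieces or contains it. *)
  have [[v [Sv lv]]|lS] := pselect (exists v, S v /\ pairing l v != 0).
    have [|y1 S1] := both _ _ S0 Sv lv 1; first by left.
    have [|y2 S2] := both _ _ S0 Sv lv (-1); first by right.
    rewrite (euler_weightE S0) (euler_weightE S1) (euler_weightE S2) (euler_weightE Sv).
    rewrite /cone_dim (lin_span_sign0 Sop S0) !(lin_span_sign Sop _ S1, lin_span_sign Sop _ S2)
      ?oppr_eq0 ?oner_eq0//.
    by rewrite -(dim_hyperplane (sub_lin_span Sv) lv) exprS mulN1r addNr add0r.
  have l0 y : S y -> pairing l y = 0.
    by move=> Sy; apply: contrapT => ly; apply: lS; exists y; split=> //; apply/eqP.
  have -> : sign_part l 0 S = S.
    by apply/seteqP; split=> y /= => [[]//|Sy]; split=> //=; rewrite l0// sgr0.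
  rewrite (@euler_weight0 (sign_part l 1 S)) ?(@euler_weight0 (sign_part l (-1) S)) ?addr0 ?add0r//.
    by move=> y [Sy /=]; rewrite l0// sgr0 => /esym/eqP; rewrite oppr_eq0 oner_eq0.
  by move=> y [Sy /=]; rewrite l0// sgr0 => /esym/eqP; rewrite oner_eq0.
rewrite [X in _ + X + _]euler_weight0 ?addr0; last by move=> y Sy; apply: none; exists y.
have [[y Sy]|Se] := pselect (exists y, S y); last first.
  rewrite !euler_weight0 ?addr0// => y => [[Sy _]|[Sy _]|Sy]; apply: Se; exists y => //.
have all1 e z : sign_part l e S z -> forall e', e' = 1 \/ e' = -1 ->
    e = 1 \/ e = -1 -> e' != e -> forall z', ~ sign_part l e' S z'.
  move=> Sz e' [->|->] [Ee|Ee]; rewrite Ee ?eqxx// in Sz * => _ z' Sz'; apply: none.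
    exact: cross Sz' Sz.
  exact: cross Sz Sz'.
have m11 : (-1 : R) != 1 by rewrite lt_eqF//; lra.
case: (sgr_cases (pairing l y)) => sy.
- have S1 : sign_part l 1 S y by [].
  rewrite [X in _ + X]euler_weight0 ?addr0; last by apply: (all1 _ _ S1); auto.
  by rewrite (euler_weightE S1) (euler_weightE Sy) /cone_dim (lin_span_sign Sop _ S1) ?oner_eq0.
- by case: none; exists y.
- have S1 : sign_part l (-1) S y by [].
  rewrite [X in X + _]euler_weight0 ?add0r; last by apply: (all1 _ _ S1); auto; rewrite eq_sym.
  by rewrite (euler_weightE S1) (euler_weightE Sy) /cone_dim (lin_span_sign Sop _ S1)
    ?oppr_eq0 ?oner_eq0.
Qed.

(** Additivity for partitions into open cones that are unions of cells of the
    arrangement of the hyperplanes in [L]. Cutting [S] with one hyperplane after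
    another reduces the claim to a set [S] that lies in a single [C i]. *)
Lemma euler_partition (I : eqType) (r : seq I) (C : I -> set 'cV[R]_n)
    (L : seq 'rV[R]_n) S :
  uniq r -> (forall i, i \in r -> open_cone (C i)) -> open_cone S ->
  (forall y, S y -> exists2 i, i \in r & C i y) ->
  (forall y i j, i \in r -> j \in r -> C i y -> C j y -> i = j) ->
  (forall i y z, i \in r -> S y -> S z ->
    (forall l, l \in L -> Num.sg (pairing l y) = Num.sg (pairing l z)) ->
    C i y -> C i z) ->
  \sum_(i <- r) euler_weight (S `&` C i) = euler_weight S.
Proof.
move=> ur Cop + + disj; elim: L S => [|l L IH] S Sop cov sgn.
  have [[y Sy]|S0] := pselect (exists y, S y); last first.
    rewrite euler_weight0 => [|y Sy]; last by apply: S0; exists y.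
    rewrite big1 // => i _; apply: euler_weight0 => y [Sy _].
    by apply: S0; exists y.
  have [i ir Ci] := cov y Sy; rewrite (bigD1_seq i)//= big_seq_cond big1 ?addr0 => [|j].
    congr euler_weight; apply/seteqP; split=> z => [[]//|Sz]; split=> //.
    by apply: sgn Ci.
  case/andP=> jr ji; apply: euler_weight0 => z [Sz Cz].
  case/negP: ji; apply/eqP; apply: (disj y) => //.
  exact: sgn Cz.
have part e : \sum_(i <- r) euler_weight (sign_part l e (S `&` C i)) =
    euler_weight (sign_part l e S).
  rewrite -IH; first by apply: eq_bigr => i _; rewrite /sign_part setIAC.
  - exact: open_cone_sign.
  - by move=> y [/cov].
  - move=> i y z ir [Sy /= ly] [Sz /= lz] yz; apply: sgn => // k.
    by rewrite inE => /predU1P[->|/yz]; rewrite ?ly.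
rewrite (euler_weight_split l Sop) -!part -!big_split/= !big_seq.
apply: eq_bigr => i ir; apply: euler_weight_split.
by apply: open_coneI => //; exact: Cop.
Qed.

Lemma open_coneT : open_cone setT.
Proof. by split=> // y v _ _; exists 1. Qed.

(** A closed half-space is the union of an open one and its boundary, of weights
    [(-1) ^+ n] and [(-1) ^+ n.-1], so it has Euler characteristic 0. On the other
    hand the part of [C i] in the half-space contributes the weight of [C i] if
    [u] is nonnegative there, and 0 otherwise: then the part of [C i] where [u] is
    negative already carries the whole weight of [C i]. *)
Lemma euler_halfspace (I : eqType) (r : seq I) (C : I -> set 'cV[R]_n)
    (L : seq 'rV[R]_n) (u : 'rV[R]_n) :
  u != 0 ->
  uniq r -> (forall i, i \in r -> open_cone (C i)) ->
  (forall i, i \in r -> exists y, C i y) ->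
  (forall y, exists2 i, i \in r & C i y) ->
  (forall y i j, i \in r -> j \in r -> C i y -> C j y -> i = j) ->
  (forall i y z, i \in r ->
    (forall l, l \in L -> Num.sg (pairing l y) = Num.sg (pairing l z)) ->
    C i y -> C i z) ->
  \sum_(i <- r | `[< forall y, C i y -> 0 <= pairing u y >]) (-1 : int) ^+ cone_dim (C i)
    = 0.
Proof.
move=> u0 ur Cop Cne cov disj sgn.
have part e : \sum_(i <- r) euler_weight (sign_part u e (C i)) =
    euler_weight (sign_part u e setT).
  rewrite -(@euler_partition _ r C L)//.
  - by apply: eq_bigr => i _; rewrite /sign_part setTI setIC.
  - exact/open_cone_sign/open_coneT.
  - by move=> i y z ir _ _; exact: sgn.
have pospart y : 0 < pairing u y -> euler_weight (sign_part u 1 setT) = (-1) ^+ n.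
  move=> uy; have Sy : sign_part u 1 setT y by split=> //=; rewrite gtr0_sg.
  rewrite (euler_weightE Sy) /cone_dim (lin_span_sign open_coneT _ Sy) ?oner_eq0//.
  have -> : lin_span setT = fullv :> {vspace 'cV[R]_n}.
    by apply/eqP; rewrite eqEsubv subvf/=; apply/subvP => z _; exact: sub_lin_span.
  by rewrite dimvf /dim/= muln1.
have [v uv] : exists v, pairing u v != 0.
  apply: contrapT => nv; case/negP: u0; apply/eqP/pairing_eq0 => y.
  by apply: contrapT => /eqP uy; apply: nv; exists y.
have zero : euler_weight (sign_part u 1 setT) + euler_weight (sign_part u 0 setT) = 0.
  have pos : exists y, 0 < pairing u y.
    case: (ltgtP (pairing u v) 0) uv => [un _|up _|_ //].
      by exists (- v); rewrite pairingNr oppr_gt0.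
    by exists v.
  case: pos => y /pospart ->.
  have S0 : sign_part u 0 setT 0 by split=> //=; rewrite pairing0r sgr0.
  rewrite (euler_weightE S0) /cone_dim (lin_span_sign0 open_coneT S0).
  have -> : lin_span setT = fullv :> {vspace 'cV[R]_n}.
    by apply/eqP; rewrite eqEsubv subvf/=; apply/subvP => z _; exact: sub_lin_span.
  have := dim_hyperplane (memvf v) uv.
  rewrite dimvf /dim/= muln1; move: (\dim _) => d dn.
  by rewrite -[X in _ ^+ X + _]dn exprS mulN1r addNr.
rewrite -[RHS]zero -!part -big_split/= [LHS]big_mkcond/= [LHS]big_seq [RHS]big_seq.
apply: eq_bigr => i ir; case: ifPn => [/asboolP uC|/asboolP nC].
  have [y Cy] := Cne _ ir; rewrite -(euler_weightE Cy) (euler_weight_split u (Cop _ ir)).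
  rewrite [X in _ + _ + X]euler_weight0 ?addr0// => z [/uC uz /= /eqP].
  by rewrite sgr_cp0; lra.
have [y Cy uy] : exists2 y, C i y & pairing u y < 0.
  apply: contrapT => ny; apply: nC => y Cy; rewrite leNgt; apply/negP => uy.
  by apply: ny; exists y.
have := euler_weight_split u (Cop _ ir).
have Sy : sign_part u (-1) (C i) y by split=> //=; rewrite ltr0_sg.
rewrite (euler_weightE Cy) (euler_weightE Sy) /cone_dim (lin_span_sign (Cop _ ir) _ Sy) ?oppr_eq0 ?oner_eq0//.
by move: (euler_weight _ + _) => X /eqP; rewrite -subr_eq subrr => /eqP.
Qed.

End Euler.

(** * Relative interiors of the cones of a fan *)

Section Relint.
Context {R : realType} {n : nat}.
Implicit Types (x : 'rV[R]_n) (y v : 'cV[R]_n) (s : set 'cV[R]_n).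

Definition cut_out s (L : seq 'rV[int]_n) : Prop :=
  forall y, s y <-> forall l, l \in L -> 0 <= pairing (toR R l) y.

(** The relative interior, described without reference to inequalities: from [y]
    one can move a little away from any point of [s] without leaving [s]. *)
Definition relint s : set 'cV[R]_n :=
  [set y | s y /\ forall v, s v -> exists2 e, 0 < e & s (y - e *: v)].

Lemma near0_all (T : eqType) (r : seq T) (Q : T -> R -> Prop) :
  (forall i, i \in r -> exists2 e, 0 < e & forall t, 0 < t -> t <= e -> Q i t) ->
  exists2 e, 0 < e & forall i, i \in r -> forall t, 0 < t -> t <= e -> Q i t.
Proof.
elim: r => [_|i r IH Qr]; first by exists 1.
have [j jr|e e0 eQ] := IH; first by apply: Qr; rewrite mem_tail.
have [|f f0 fQ] := Qr i; first by rewrite mem_head.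
exists (Num.min e f) => [|j]; first by rewrite lt_min e0.
rewrite inE => jir t t0; rewrite le_min => /andP[te tf].
by case/predU1P: jir => [->|jr]; [exact: fQ|exact: eQ].
Qed.

Lemma cut_out_add s L y z : cut_out s L -> s y -> s z -> s (y + z).
Proof.
by move=> sL /sL sy /sL sz; apply/sL => l lL; rewrite pairingDr addr_ge0 ?sy ?sz.
Qed.

Lemma cut_out_scale s L c y : cut_out s L -> 0 <= c -> s y -> s (c *: y).
Proof.
by move=> sL c0 /sL sy; apply/sL => l lL; rewrite pairingZr mulr_ge0 ?sy.
Qed.

(** If [l y = 0] and [l v > 0], moving from [y] away from [v] makes [l] negative:
    an interior point lies on no wall that does not contain the whole cone. *)
Lemma relintP s L : cut_out s L -> forall y, relint s y <->
  forall l, l \in L -> 0 <= pairing (toR R l) y /\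
    (pairing (toR R l) y = 0 -> forall v, s v -> pairing (toR R l) v = 0).
Proof.
move=> sL y; split=> [[/[dup] sy /sL Ly ys] l lL|yL].
  split=> [|ly v /[dup] sv /sL Lv]; first exact: Ly.
  have [e e0 /sL/(_ _ lL)] := ys v sv.
  rewrite !pairingE ly sub0r oppr_ge0 pmulr_rle0// => lv.
  by apply/eqP; rewrite eq_le lv Lv.
split=> [|v /[dup] sv /sL Lv]; first by apply/sL => l /yL[].
have [l lL|e e0 eL] := @near0_all _ L
  (fun l t => 0 <= pairing (toR R l) (y - t *: v)); last first.
  by exists e => //; apply/sL => l lL; apply: eL.
have [ly0 ly] := yL l lL.
have [l0|l0] := eqVneq (pairing (toR R l) y) 0.
  by exists 1 => // t _ _; rewrite !pairingE l0 (ly l0) // mulr0 subr0.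
have [e e0 le] := sg_perturb (pairing (toR R l) (- v)) l0.
exists e => // t t0 te; rewrite -scalerN !pairingE -pairingNr -sgr_ge0 le// sgr_ge0.
exact: ly0.
Qed.

Lemma relint_sub s : relint s `<=` s.
Proof. by move=> y []. Qed.

(** For each form of [L] that is not zero on [s] take a point of [s] where it is
    positive; the sum of these points is interior. *)
Lemma relint_nonempty s L : cut_out s L -> exists y, relint s y.
Proof.
move=> sL.
suff [y sy yP] : exists2 y, s y & forall l, l \in L -> pairing (toR R l) y = 0 ->
    forall v, s v -> pairing (toR R l) v = 0.
  by exists y; apply/(relintP sL) => l lL; split; [apply: (sL y).1|exact: yP].
suff H (L' : seq 'rV[int]_n) : {subset L' <= L} -> exists2 y, s y & forall l, l \in L' ->
  pairing (toR R l) y = 0 -> forall v, s v -> pairing (toR R l) v = 0 by exact: H.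
elim: L' => [_|l L' IH LL].
  by exists 0 => //; apply/sL => l _; rewrite pairing0r.
have [k kL|y sy yP] := IH; first by apply: LL; rewrite mem_tail.
have [[v [sv lv]]|l0] := pselect (exists v, s v /\ pairing (toR R l) v != 0).
  exists (y + v) => [|k kL]; first exact: (cut_out_add sL).
  have ky := (sL y).1 sy k (LL _ kL); have kv := (sL v).1 sv k (LL _ kL).
  rewrite pairingDr => /eqP; rewrite paddr_eq0// => /andP[/eqP ky0 /eqP kv0].
  move: kL kv0; rewrite inE => /predU1P[->|kL _]; last exact: yP.
  by move=> lv0; rewrite lv0 eqxx in lv.
exists y => // k; rewrite inE => /predU1P[->|kL]; last exact: yP.
by move=> _ v sv; apply: contrapT => /eqP lv; apply: l0; exists v.
Qed.

Lemma relint_add s L y v : cut_out s L -> relint s y -> s v -> relint s (y + v).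
Proof.
move=> sL /(relintP sL) ys sv; apply/(relintP sL) => l lL; have [ly ly0] := ys l lL.
have lv := (sL v).1 sv l lL; rewrite pairingDr; split; first exact: addr_ge0.
by move=> /eqP; rewrite paddr_eq0// => /andP[/eqP/ly0].
Qed.

Lemma lin_span_relint s L : cut_out s L -> lin_span (relint s) = lin_span s.
Proof.
move=> sL; apply/eqP; rewrite eqEsubv; apply/andP; split.
  by apply: lin_span_sub; exact: relint_sub.
apply: lin_span_min => v sv; have [y ys] := relint_nonempty sL.
by rewrite -(addKr y v) rpredD ?rpredN ?sub_lin_span//; exact: relint_add sv.
Qed.

Lemma open_cone_relint s L : cut_out s L -> open_cone (relint s).
Proof.
move=> sL; split=> [y z a b a0 b0 /(relintP sL) ys /(relintP sL) zs|y v].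
  apply/(relintP sL) => l lL; have [ly ly0] := ys l lL; have [lz lz0] := zs l lL.
  rewrite !pairingE; split; first by rewrite addr_ge0// mulr_ge0// ltW.
  move=> /eqP; rewrite paddr_eq0 ?mulr_ge0// ?ltW// => /andP[/eqP + _].
  by move/eqP; rewrite mulf_eq0 gt_eqF//= => /eqP.
rewrite (lin_span_relint sL) => /(relintP sL) ys vs.
have [l lL|e e0 eL] := @near0_all _ L (fun l t => 0 <= pairing (toR R l) (y + t *: v) /\
    (pairing (toR R l) (y + t *: v) = 0 -> forall v, s v -> pairing (toR R l) v = 0));
  last first.
  by exists e => // t t0 te; apply/(relintP sL) => l lL; apply: eL.
have [ly0 ly] := ys l lL.
have [l0|l0] := eqVneq (pairing (toR R l) y) 0.
  exists 1 => // t _ _; rewrite !pairingE l0 add0r.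
  by rewrite (lin_span_ker (ly l0) vs) mulr0; split=> // _; exact: ly.
have [e e0 le] := sg_perturb (pairing (toR R l) v) l0.
exists e => // t t0 te; rewrite !pairingE; split.
  by rewrite -sgr_ge0 le// sgr_ge0.
by move/eqP; rewrite -sgr_eq0 le// sgr_eq0 (negbTE l0).
Qed.

Lemma relint_sgn s L y z : cut_out s L ->
  (forall l, l \in L -> Num.sg (pairing (toR R l) y) = Num.sg (pairing (toR R l) z)) ->
  relint s y -> relint s z.
Proof.
move=> sL yz /(relintP sL) ys; apply/(relintP sL) => l lL; have [ly ly0] := ys l lL.
split; first by rewrite -sgr_ge0 -yz// sgr_ge0.
by move=> /eqP; rewrite -sgr_eq0 -yz// sgr_eq0 => /eqP/ly0.
Qed.

Lemma pairing_suml (I : Type) (r : seq I) (P : pred I) (F : I -> 'rV[R]_n) y :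
  pairing (\sum_(i <- r | P i) F i) y = \sum_(i <- r | P i) pairing (F i) y.
Proof. by rewrite /pairing mulmx_suml summxE. Qed.

(** The face is cut out by the sum of those forms of [L] that vanish at [y]; as
    they are nonnegative on [s], they all vanish where their sum does. *)
Lemma relint_face s L y : cut_out s L -> s y ->
  exists t : set 'cV[R]_n, face t s /\ relint t y.
Proof.
move=> sL sy; have Ly := (sL y).1 sy.
pose Z := [seq l <- L | pairing (toR R l) y == 0].
pose x := \sum_(l <- Z) toR R l.
have ZL l : l \in Z -> l \in L by rewrite mem_filter => /andP[].
have xs : dual_cone s x.
  move=> v /sL Lv; rewrite pairing_suml big_seq sumr_ge0// => l /ZL.
  exact: Lv.
exists (s `&` [set v | pairing x v = 0]); split; first by exists x.
split=> [|v [/sL Lv /= xv]].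
  split=> //=; rewrite pairing_suml big_seq big1// => l.
  by rewrite mem_filter => /andP[/eqP].
have xy : pairing x y = 0.
  rewrite pairing_suml big_seq big1// => l.
  by rewrite mem_filter => /andP[/eqP].
have Zv l : l \in Z -> pairing (toR R l) v = 0.
  move=> lZ; move: xv; rewrite pairing_suml => /eqP.
  rewrite big_seq psumr_eq0 => [/allP/(_ l)|k /ZL/Lv//].
  by rewrite lZ /= => /(_ isT) /eqP.
have [l lL|e e0 eL] := @near0_all _ L
  (fun l t => 0 <= pairing (toR R l) (y - t *: v)); last first.
  exists e => //; split; first by apply/sL => l lL; apply: eL.
  by rewrite /= !pairingE xv xy mulr0 subr0.
have [l0|l0] := eqVneq (pairing (toR R l) y) 0.
  exists 1 => // t _ _; rewrite !pairingE l0 Zv ?mulr0 ?subr0//.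
  by rewrite mem_filter l0 eqxx.
have [e e0 le] := sg_perturb (pairing (toR R l) (- v)) l0.
exists e => // t t0 te; rewrite -scalerN !pairingE -pairingNr -sgr_ge0 le// sgr_ge0.
exact: Ly.
Qed.

Lemma relint_face_eq s (t : set 'cV[R]_n) y : face t s -> t y -> relint s y -> t = s.
Proof.
move=> [x [xs ->]] [_ /= xy] [sy ys]; apply/seteqP; split=> v; first by case.
move=> sv; split=> //=; have [e e0 /xs] := ys v sv.
rewrite !pairingE xy sub0r oppr_ge0 pmulr_rle0// => xv.
by apply/eqP; rewrite eq_le xv xs.
Qed.

Lemma fan_cut_out (Sigma : {fset set 'cV[R]_n}) : is_fan Sigma ->
  exists L, forall s, s \in Sigma -> cut_out s (L s).
Proof.
move=> [rat _ _].
have ex s : exists L, s \in Sigma -> cut_out s L.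
  have [sS|] := boolP (s \in Sigma); last by exists [::].
  by have [_ [L [_ sL]]] := rational_coneP (rat _ sS).1; exists L.
exists (fun s => sval (cid (ex s))) => s sS.
by case: (cid (ex s)) => L /= /(_ sS).
Qed.

(** With [fan_relint_disjoint]: the relative interiors of the cones of a complete
    fan form a partition of the space. *)
Lemma fan_relint_cover (Sigma : {fset set 'cV[R]_n}) y :
  is_fan Sigma -> complete_fan Sigma -> exists2 s, s \in Sigma & relint s y.
Proof.
move=> fan /(_ y)[s sS sy]; have [L LP] := fan_cut_out fan.
have [t [ts ty]] := relint_face (LP _ sS) sy; exists t => //.
by case: fan => _ /(_ s t sS ts).
Qed.

Lemma fan_relint_disjoint (Sigma : {fset set 'cV[R]_n}) y s t :
  is_fan Sigma -> s \in Sigma -> t \in Sigma -> relint s y -> relint t y -> s = t.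
Proof.
move=> [_ _ /(_ s t) int] sS tS ys yt; have [fs ft] := int sS tS.
have yst : (s `&` t) y by split; apply: relint_sub.
exact: etrans (esym (relint_face_eq fs yst ys)) (relint_face_eq ft yst yt).
Qed.

(** Induction on [B]: an interval with one more point of [B] inside is cut there. *)
Lemma breakpoints (B : seq R) (Q : R -> R -> Prop) :
  (forall p q, p < q -> (forall b, b \in B -> ~~ (p < b < q)) -> Q p q) ->
  (forall p r q, p < r -> r < q -> Q p r -> Q r q -> Q p q) ->
  forall p q, p < q -> Q p q.
Proof.
move=> + tr; elim: B => [Q0 p q pq|b B IH QB]; first exact: Q0.
apply: IH => p q pq pqB.
have sub p' q' : p <= p' -> q' <= q -> p' < q' -> ~~ (p' < b < q') -> Q p' q'.
  move=> pp qq pq' nb; apply: QB => // c; rewrite inE => /predU1P[->//|/pqB].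
  by apply: contra => /andP[pc cq]; rewrite (le_lt_trans pp pc) (lt_le_trans cq qq).
have [/andP[pb bq]|] := boolP (p < b < q); last exact: sub.
by apply: (tr _ b) => //; apply: sub => //; rewrite ?ltxx ?andbF ?ltW.
Qed.

End Relint.

(** * Deforming a complete fan *)

Section Shear.
Context {R : realType} {n : nat}.

Lemma cone_dim_linear (S T : set 'cV[R]_n) (f g : {linear 'cV[R]_n -> 'cV[R]_n}) :
  cancel f g -> (forall y, S y -> T (f y)) -> (forall z, T z -> S (g z)) ->
  (forall z, T z -> f (g z) = z) -> cone_dim S = cone_dim T.
Proof.
move=> fK ST TS gK; rewrite /cone_dim.
suff -> : lin_span T = (linfun f @: lin_span S)%VS.
  rewrite limg_dim_eq//; apply/eqP; rewrite -subv0; apply/subvP => y.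
  rewrite memv_cap memv_ker lfunE/= => /andP[_ /eqP fy].
  by rewrite memv0 -(fK y) fy linear0.
apply/eqP; rewrite eqEsubv; apply/andP; split.
  apply: lin_span_min => z Tz; rewrite -(gK z Tz) -[f _]lfunE memv_img//.
  exact/sub_lin_span/TS.
apply/subvP => _ /memv_imgP[y yS ->]; rewrite lfunE/=.
have /subvP sub : (lin_span S <= linfun f @^-1: lin_span T)%VS.
  by apply: lin_span_min => z /ST fz; rewrite -memv_preim lfunE sub_lin_span.
by have := sub _ yS; rewrite -memv_preim lfunE.
Qed.

(** The linear map behind the deformation of a fan: on each cone of the fan the
    piecewise linear map used in [fan_euler_vanish] is of this form. *)
Definition shear (g : 'rV[R]_n) (y0 y : 'cV[R]_n) : 'cV[R]_n := y + pairing g y *: y0.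

Lemma shear_linear g y0 : linear (shear g y0).
Proof.
move=> c y z; rewrite /shear !pairingE scalerDl scalerDr scalerA; rewrite -!addrA.
by congr (_ + _); rewrite addrCA.
Qed.
HB.instance Definition _ g y0 :=
  GRing.isLinear.Build R 'cV[R]_n 'cV[R]_n _ (shear g y0) (shear_linear g y0).

(** With [shearKV]: a shear maps [y0] to a multiple of itself; if the
    factor is nonzero, the shear is invertible by another shear. *)
Lemma shearK g y0 : 1 + pairing g y0 != 0 ->
  cancel (shear g y0) (shear (- ((1 + pairing g y0)^-1 *: g)) y0).
Proof.
move=> k0 y; rewrite /shear !pairingE.
rewrite -addrA -scalerDl (_ : pairing g y + _ = 0) ?scale0r ?addr0//.
by field.
Qed.

Lemma shearKV g y0 : 1 + pairing g y0 != 0 ->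
  cancel (shear (- ((1 + pairing g y0)^-1 *: g)) y0) (shear g y0).
Proof.
move=> k0 y; rewrite /shear !pairingE.
rewrite -addrA -scalerDl (_ : - _ + _ = 0) ?scale0r ?addr0//.
by field.
Qed.

Lemma open_cone_preimage (S : set 'cV[R]_n) (f : {linear 'cV[R]_n -> 'cV[R]_n}) :
  open_cone S -> open_cone [set z | S (f z)].
Proof.
move=> [Sc So]; split=> [y z a b a0 b0 /= Sy Sz|y v /= Sy vS].
  by rewrite linearD !linearZ; exact: Sc.
have fv : f v \in lin_span S.
  have /subvP sub : (lin_span [set z | S (f z)] <= linfun f @^-1: lin_span S)%VS.
    by apply: lin_span_min => z fz; rewrite -memv_preim lfunE sub_lin_span.
  by have := sub _ vS; rewrite -memv_preim lfunE.
have [e e0 eS] := So _ _ Sy fv; exists e => // t t0 te.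
by rewrite linearD linearZ; exact: eS.
Qed.

(** On an interval of the line without zeros of the forms, the signs of the forms
    are constant, so a cone cut out by some of them contains the closed interval
    as soon as it contains an interior point. The zeros depend on [L] alone. *)
Lemma line_breakpoints (L : seq 'rV[int]_n) (y y0 : 'cV[R]_n) : exists B : seq R,
  forall (s : set 'cV[R]_n) p q r, cut_out s L -> p < r -> r < q ->
    (forall b, b \in B -> ~~ (p < b < q)) ->
    s (y + r *: y0) -> s (y + p *: y0) /\ s (y + q *: y0).
Proof.
exists [seq - pairing (toR R l) y / pairing (toR R l) y0 | l <- L].
move=> s p q r sL pr rq pqB /sL sr.
suff nn l c : l \in L -> p <= c -> c <= q -> 0 <= pairing (toR R l) (y + c *: y0).
  have pq := ltW (lt_trans pr rq).
  by split; apply/sL => l lL; apply: nn.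
move=> lL pc cq; have := sr _ lL.
have : ~~ (p < - pairing (toR R l) y / pairing (toR R l) y0 < q) by apply: pqB; exact: map_f.
rewrite !pairingE; move: (pairing _ y) (pairing _ y0) => P Q.
have [->|Q0] := eqVneq Q 0; first by rewrite !mulr0.
have E z : P + z * Q = (z - (- P / Q)) * Q by field.
rewrite !E; move: (- P / Q) => d pdq.
case: (ltgtP Q 0) Q0 => [Qn _|Qp _|//].
  by rewrite !(nmulr_lge0 _ Qn) => rd; move: pdq; rewrite negb_and -!leNgt => /orP[]; lra.
by rewrite !(pmulr_lge0 _ Qp) => rd; move: pdq; rewrite negb_and -!leNgt => /orP[]; lra.
Qed.

(** The map [Psi] moves points along [y0] so that the piecewise linear function
    [g] becomes the linear form [u]. It is bijective because [g] increases with
    slope at least 1 on every line of direction [y0], and it is linear and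
    injective on the span of each cone. The images of the relative interiors form
    a partition into open cones of the same dimensions, and [g] is nonnegative on
    a cone iff [u] is nonnegative on its image: the half-space lemma applies. *)
Lemma fan_euler_vanish (Sigma : {fset set 'cV[R]_n}) (g : 'cV[R]_n -> R)
    (gs : set 'cV[R]_n -> 'rV[R]_n) (u : 'rV[R]_n) (y0 : 'cV[R]_n) :
  is_fan Sigma -> complete_fan Sigma ->
  (forall s, s \in Sigma -> forall y, s y -> g y = pairing (gs s) y) ->
  pairing u y0 = 1 -> (forall s, s \in Sigma -> 1 <= pairing (gs s) y0) ->
  \sum_(s <- Sigma | `[< dual_cone s (gs s) >]) (-1 : int) ^+ cone_dim s = 0.
Proof.
move=> fan compl gE uy0 gs1; have [L LP] := fan_cut_out fan.
pose G s := gs s - u.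
have G1 s : 1 + pairing (G s) y0 = pairing (gs s) y0 by rewrite !pairingE uy0; ring.
have Gn0 s : s \in Sigma -> 1 + pairing (G s) y0 != 0.
  by move=> /gs1 gs1s; rewrite G1 gt_eqF//; lra.
pose V s := - ((1 + pairing (G s) y0)^-1 *: G s).
pose Psi y := y + (g y - pairing u y) *: y0.
have PsiE s y : s \in Sigma -> s y -> Psi y = shear (G s) y0 y.
  by move=> sS sy; rewrite /Psi (gE s) // /shear !pairingE.
have uPsi y : pairing u (Psi y) = g y by rewrite !pairingE uy0; ring.
(* Along lines of direction y0 the function g has slope at least 1 and takes all
   intermediate values. *)
have lineP y p q : p < q ->
    [/\ q - p <= g (y + q *: y0) - g (y + p *: y0) &
     forall c, g (y + p *: y0) <= c -> c <= g (y + q *: y0) -> exists r, g (y + r *: y0) = c].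
  have [B BP] : exists B : seq R, forall s p q r, s \in Sigma -> p < r -> r < q ->
      (forall b, b \in B -> ~~ (p < b < q)) ->
      s (y + r *: y0) -> s (y + p *: y0) /\ s (y + q *: y0).
    have ex s : exists B : seq R, s \in Sigma -> forall p q r, p < r -> r < q ->
      (forall b, b \in B -> ~~ (p < b < q)) ->
      s (y + r *: y0) -> s (y + p *: y0) /\ s (y + q *: y0).
      have [B BP] := line_breakpoints (L s) y y0; exists B => sS p' q' r.
      exact: (BP s p' q' r (LP _ sS)).
    pose Bs s := sval (cid (ex s)).
    exists (flatten [seq Bs s | s <- enum_fset Sigma]) => s p' q' r sS pr rq pqB.
    rewrite /Bs in pqB; apply: (svalP (cid (ex s)) sS _ _ _ pr rq) => b bB.
    by apply: pqB; apply/flattenP; exists (sval (cid (ex s))) => //; apply/mapP; exists s.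
  apply: (@breakpoints R B (fun p q => [/\ q - p <= g (y + q *: y0) - g (y + p *: y0) &
     forall c, g (y + p *: y0) <= c -> c <= g (y + q *: y0) ->
       exists r, g (y + r *: y0) = c])) => {p q} [p q pq pqB|p r q pr rq [pr1 pr2] [rq1 rq2]].
    pose r := (p + q) / 2; have pr : p < r by rewrite /r; lra.
    have rq : r < q by rewrite /r; lra.
    have [s sS sr] := compl (y + r *: y0).
    have [sp sq] := BP s p q r sS pr rq pqB sr.
    rewrite (gE s sS _ sp) (gE s sS _ sq) !pairingE; have k1 := gs1 s sS.
    move kE: (pairing (gs s) y0) k1 => k k1.
    split; first by nra.
    move=> c pc cq.
    (* The point p + e at which the affine function takes the value c. *)
    pose e := (c - (pairing (gs s) y + p * k)) / k; have k0 : k != 0 by rewrite gt_eqF//; lra.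
    have eE : e * k = c - (pairing (gs s) y + p * k) by rewrite divfK.
    exists (p + e).
    have e0 : 0 <= e by nra.
    have eq : p + e <= q by nra.
    have qp : 0 < q - p by lra.
    have sc : s (y + (p + e) *: y0).
      have -> : y + (p + e) *: y0 = ((q - (p + e)) / (q - p)) *: (y + p *: y0) +
          (e / (q - p)) *: (y + q *: y0).
        rewrite !scalerDr !scalerA addrACA -!scalerDl.
        by congr (_ + _); [rewrite -[LHS]scale1r|]; congr (_ *: _); field; lra.
      by apply: (cut_out_add (LP _ sS)); apply: (cut_out_scale (LP _ sS)) => //;
        rewrite divr_ge0//; lra.
    by rewrite (gE s sS _ sc) !pairingE kE mulrDl eE; ring.
  split=> [|c cp cq]; first by move: pr1 rq1; lra.
  have [cr|rc] := leP c (g (y + r *: y0)); first exact: pr2.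
  by apply: rq2 => //; exact: ltW.
have Psi_inj y z : Psi y = Psi z -> y = z.
  move=> yz; have gyz : g y = g z by rewrite -!uPsi yz.
  have zE : z = y + (pairing u z - pairing u y) *: y0.
    apply: (addIr ((g z - pairing u z) *: y0)); move: yz; rewrite /Psi gyz => <-.
    by rewrite -addrA -scalerDl; congr (_ + _ *: _); ring.
  move: (_ - _) zE gyz => r -> gyz.
  have [r0|r0|->] := ltgtP (r : R) (0 : R); last by rewrite scale0r addr0.
    by exfalso; have [+ _] := lineP y _ _ r0; rewrite scale0r addr0 gyz; lra.
  by exfalso; have [+ _] := lineP y _ _ r0; rewrite scale0r addr0 gyz; lra.
have Psi_surj z : exists y, Psi y = z.
  (* Psi (z + r y0) = z amounts to g (z + r y0) = u z; as g has slope at least 1,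
     this value is reached between - d and d. *)
  pose d := `|pairing u z - g z| + 1.
  have d0 : 0 < d by rewrite ltr_wpDl.
  have [r rE] : exists r, g (z + r *: y0) = pairing u z.
    have [q1 _] := lineP z _ _ d0; have nd0 : - d < 0 by lra.
    have [q2 _] := lineP z _ _ nd0; have ndd : - d < d by lra.
    have [_] := lineP z _ _ ndd; apply.
      move: q2; rewrite scale0r addr0 /d.
      by have := ler_norm (- (pairing u z - g z)); rewrite normrN; lra.
    move: q1; rewrite scale0r addr0 /d.
    by have := ler_norm (pairing u z - g z); lra.
  exists (z + r *: y0); rewrite /Psi rE !pairingE uy0 -addrA -scalerDl.
  by rewrite (_ : r + _ = 0) ?scale0r ?addr0//; ring.
pose C s := [set z | relint s (shear (V s) y0 z)].
have CP s : s \in Sigma -> forall z, C s z <-> exists2 y, relint s y & Psi y = z.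
  move=> sS z; split=> [Cz|[y ys <-]].
    exists (shear (V s) y0 z) => //; rewrite (PsiE s)//; last exact: relint_sub.
    exact/shearKV/Gn0.
  by rewrite /C /= (PsiE s) ?shearK//; [exact: Gn0|exact: relint_sub].
have dimC s : s \in Sigma -> cone_dim (C s) = cone_dim s.
  move=> sS; rewrite -[RHS](_ : cone_dim (relint s) = _); last first.
    by rewrite /cone_dim (lin_span_relint (LP _ sS)).
  apply/esym/(@cone_dim_linear _ _ (shear (G s) y0) (shear (V s) y0)) => //.
  - exact/shearK/Gn0.
  - by move=> y ys; rewrite /C /= shearK//; exact: Gn0.
  - by move=> z _; apply/shearKV/Gn0.
have dualC s : s \in Sigma ->
    `[< dual_cone s (gs s) >] = `[< forall z, C s z -> 0 <= pairing u z >].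
  move=> sS; apply/asboolP/asboolP => [ds z /(CP s sS)[y ys <-]|uC v sv].
    by rewrite uPsi (gE s)//; [apply: ds|]; apply: relint_sub.
  (* A negative value at v would persist at y + N v for large N, inside relint s. *)
  have pos y : relint s y -> 0 <= pairing (gs s) y.
    move=> ys; rewrite -(gE s)//; last exact: relint_sub.
    by rewrite -uPsi; apply: uC; apply/CP => //; exists y.
  have [y ys] := relint_nonempty (LP _ sS).
  rewrite leNgt; apply/negP => v0; have y0' := pos _ ys.
  pose N := (pairing (gs s) y + 1) / (- pairing (gs s) v).
  have Nv : N * (- pairing (gs s) v) = pairing (gs s) y + 1 by rewrite divfK// oppr_eq0 lt_eqF.
  have N0 : 0 <= N by rewrite divr_ge0//; lra.
  have := pos _ (relint_add (LP _ sS) ys (cut_out_scale (LP _ sS) N0 sv)).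
  by rewrite !pairingE; lra.
have u0 : u != 0 by apply: contra_eq_neq uy0 => ->; rewrite pairing0l eq_sym oner_eq0.
pose LL := flatten [seq [seq toR R l + pairing (toR R l) y0 *: V s | l <- L s]
  | s <- enum_fset Sigma].
transitivity (\sum_(s <- Sigma | `[< forall z, C s z -> 0 <= pairing u z >])
    (-1 : int) ^+ cone_dim (C s)).
  rewrite [LHS]big_mkcond [RHS]big_mkcond/= !big_seq; apply: eq_bigr => s sS.
  by rewrite dualC// dimC.
apply: (@euler_halfspace _ _ _ (enum_fset Sigma) C LL u u0).
- exact: fset_uniq.
- by move=> s sS; exact: (@open_cone_preimage (relint s) (shear (V s) y0) (open_cone_relint (LP _ sS))).
- move=> s sS; have [y ys] := relint_nonempty (LP _ sS).
  by exists (Psi y); apply/CP => //; exists y.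
- move=> z; have [y <-] := Psi_surj z; have [s sS ys] := fan_relint_cover y fan compl.
  by exists s => //; apply/CP => //; exists y.
- move=> z s t sS tS /(CP s sS)[y ys <-] /(CP t tS)[y' yt /Psi_inj yy].
  by move: yt; rewrite yy => yt; exact: (fan_relint_disjoint fan sS tS ys yt).
- move=> s y z sS yz; apply: (relint_sgn (LP _ sS)) => l lL.
  have e v : pairing (toR R l) (shear (V s) y0 v) =
      pairing (toR R l + pairing (toR R l) y0 *: V s) v.
    by rewrite /shear !(pairingDr, pairingDl, pairingZl, pairingZr) mulrC.
  rewrite !e; apply: yz; apply/flattenP.
  by eexists; [apply/mapP; exists s; [exact: sS|reflexivity]|apply/mapP; exists l].
Qed.

End Shear.

(** * Infinite sets of lattice points *)

Section Escape.
Context {n : nat}.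
Implicit Types (a u : 'rV[int]_n) (b : 'cV[int]_n) (X : set 'rV[int]_n).

Lemma idotDl a a' b : idot (a + a') b = idot a b + idot a' b.
Proof. by rewrite /idot mulmxDl mxE. Qed.
Lemma idotNl a b : idot (- a) b = - idot a b.
Proof. by rewrite /idot mulNmx mxE. Qed.

Lemma infinite_set_avoid (I : eqType) (r : seq I) (bad : I -> set 'rV[int]_n) X :
  infinite_set X -> (forall i, i \in r -> finite_set (X `&` bad i)) ->
  infinite_set (X `&` [set a | forall i, i \in r -> ~ bad i a]).
Proof.
move=> Xinf; elim: r => [_|i r IH fin].
  by apply: contra_not Xinf; apply: sub_finite_set => a Xa; split.
have Yinf := IH (fun j jr => fin j (mem_tail _ jr)).
move=> Zfin; apply: Yinf.
have fini : finite_set (X `&` bad i) by apply: fin; rewrite mem_head.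
have fin2 : finite_set ((X `&` [set a | forall j, j \in i :: r -> ~ bad j a])
    `|` (X `&` bad i)) by rewrite finite_setU; split.
apply: sub_finite_set fin2 => a [Xa /= ar].
have [bi|nbi] := pselect (bad i a); [by right|left; split=> //= j].
by rewrite inE => /predU1P[->|/ar].
Qed.

(** On [X] the values of [b] are constant or go to infinity with a definite sign.
    Every infinite set contains an infinite set that is tame for a given [b], and
    tameness passes to subsets. *)
Definition tame X b : Prop :=
  [\/ exists c, forall a, X a -> idot a b = c,
      forall K, finite_set (X `&` [set a | idot a b < K])
    | forall K, finite_set (X `&` [set a | K < idot a b])].

Lemma tame_sub X Y b : X `<=` Y -> tame Y b -> tame X b.
Proof.
move=> XY [[c Yc]|Yf|Yf].
- by constructor 1; exists c => a /XY/Yc.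
- by constructor 2 => K; apply: sub_finite_set (Yf K) => a [/XY].
- by constructor 3 => K; apply: sub_finite_set (Yf K) => a [/XY].
Qed.

Lemma tame_one X b : infinite_set X ->
  exists Y, [/\ Y `<=` X, infinite_set Y & tame Y b].
Proof.
move=> Xinf.
have [[c cinf]|fin] := pselect (exists c, infinite_set (X `&` [set a | idot a b = c])).
  exists (X `&` [set a | idot a b = c]); split; [exact: subIsetl|exact: cinf|].
  by constructor 1; exists c => a [].
have slab (c : int) (k : nat) : finite_set (X `&` [set a | c <= idot a b < c + k%:Z]).
  elim: k => [|k IH].
    apply: sub_finite_set (finite_set0 _) => a [_ /=]; lia.
  have fk : finite_set (X `&` [set a | idot a b = c + k%:Z]).
    by apply: contrapT => ifk; apply: fin; exists (c + k%:Z).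
  have fU : finite_set ((X `&` [set a | c <= idot a b < c + k%:Z]) `|`
     (X `&` [set a | idot a b = c + k%:Z])) by rewrite finite_setU; split.
  apply: sub_finite_set fU => a [Xa /= ak].
  by have [e|ne] := eqVneq (idot a b) (c + k%:Z); [right|left; split=> //=; lia].
have [inf0|fin0] := pselect (infinite_set (X `&` [set a | 0 <= idot a b])).
  exists (X `&` [set a | 0 <= idot a b]); split; [exact: subIsetl|exact: inf0|].
  constructor 2 => K; apply: sub_finite_set (slab 0 `|K|%N) => a [[Xa /= a0] aK].
  by split=> //=; lia.
exists (X `&` [set a | idot a b < 0]); split; first exact: subIsetl.
  move=> finn; apply: Xinf.
  have fU : finite_set ((X `&` [set a | 0 <= idot a b]) `|` (X `&` [set a | idot a b < 0])).
    by rewrite finite_setU; split=> //; exact: contrapT.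
  apply: sub_finite_set fU => a Xa.
  by have [a0|a0] := leP 0 (idot a b); [left|right].
constructor 3 => K; apply: sub_finite_set (slab (- `|K|) `|K|%N) => a [[Xa /= a0] aK].
by split=> //=; lia.
Qed.

Lemma tame_all X (B : seq 'cV[int]_n) : infinite_set X ->
  exists Y, [/\ Y `<=` X, infinite_set Y & forall b, b \in B -> tame Y b].
Proof.
elim: B X => [|b B IH] X Xinf; first by exists X; split.
have [Y [YX Yinf Yb]] := tame_one b Xinf.
have [Z [ZY Zinf ZB]] := IH Y Yinf.
exists Z; split; [exact: subset_trans YX|exact: Zinf|move=> c].
by rewrite inE => /predU1P[->|/ZB//]; exact: tame_sub Yb.
Qed.

(** An infinite set of lattice points has a direction [u] of escape and a point
    [a] that is already far away: moving from [a] along [u] changes no sign of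
    [idot _ b + k] with [|k| < K]. On a tame infinite subset take two points,
    the second much farther away than the first, and let [u] be their difference. *)
Lemma escape X (B : seq 'cV[int]_n) (K : int) : infinite_set X ->
  exists a u, [/\ X a, u != 0 & forall b, b \in B ->
    [\/ idot u b = 0, 0 < idot u b /\ K <= idot a b | idot u b < 0 /\ idot a b <= - K]].
Proof.
move=> /(tame_all B)[Y [YX Yinf YB]].
have pick (Z : set 'rV[int]_n) : infinite_set Z -> exists a, Z a.
  move=> Zinf; apply: contrapT => nZ; apply: Zinf.
  by apply: sub_finite_set (finite_set0 _) => a Za; apply: nZ; exists a.
(* Constant at b, or at least as far as k b in the direction in which Y escapes. *)
pose beyond (k : 'cV[int]_n -> int) (b : 'cV[int]_n) (a : 'rV[int]_n) : Prop :=
  [\/ exists c, forall a', Y a' -> idot a' b = c,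
      (forall k', finite_set (Y `&` [set a | idot a b < k'])) /\ k b <= idot a b
    | (forall k', finite_set (Y `&` [set a | k' < idot a b])) /\ idot a b <= - k b].
have beyondP k b : b \in B -> finite_set (Y `&` [set a | ~ beyond k b a]).
  move=> /YB[Yc|Yf|Yf].
  - by apply: sub_finite_set (finite_set0 _) => a [_ /=]; apply; constructor 1.
  - apply: sub_finite_set (Yf (k b)) => a [Ya /= nab]; split=> //=.
    by rewrite ltNge; apply/negP => kb; apply: nab; constructor 2.
  - apply: sub_finite_set (Yf (- k b)) => a [Ya /= nab]; split=> //=.
    by rewrite ltNge; apply/negP => kb; apply: nab; constructor 3.
have [a [Ya aB]] := pick _ (infinite_set_avoid Yinf (beyondP (fun=> K))).
(* The second point is to be farther out than the first one. *)
pose k b := `|idot a b| + 1.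
have Y'inf : infinite_set (Y `&` [set a' | forall b, b \in B -> ~ ~ beyond k b a'] `\ a).
  by apply: infinite_setD (infinite_set_avoid Yinf (beyondP k)) (finite_set1 a).
have [a' [[Ya' a'B] /= a'a]] := pick _ Y'inf.
exists a, (a' - a); split; first exact: YX.
  by rewrite subr_eq0; apply/eqP.
move=> b bB; rewrite idotDl idotNl.
have /contrapT ab := aB b bB; have /contrapT a'b := a'B b bB.
case: a'b => [[c Yc]|[Yf kb]|[Yf kb]].
- by constructor 1; rewrite !Yc// subrr.
- case: ab => [[c Yc]|[_ kb']|[Yf' kb']].
  + by constructor 1; rewrite !Yc// subrr.
  + by constructor 2; split=> //; rewrite /k in kb; lia.
  + exfalso; apply: Yinf; have fU : finite_set ((Y `&` [set a | idot a b < 0]) `|`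
      (Y `&` [set a | - 1 < idot a b])) by rewrite finite_setU; split.
    apply: sub_finite_set fU => y Yy.
    by have [y0|y0] := ltP (idot y b) 0; [left|right; split=> //=; lia].
- case: ab => [[c Yc]|[Yf' kb']|[_ kb']].
  + by constructor 1; rewrite !Yc// subrr.
  + exfalso; apply: Yinf; have fU : finite_set ((Y `&` [set a | idot a b < 0]) `|`
      (Y `&` [set a | - 1 < idot a b])) by rewrite finite_setU; split.
    apply: sub_finite_set fU => y Yy.
    by have [y0|y0] := ltP (idot y b) 0; [left|right; split=> //=; lia].
  + by constructor 3; split=> //; rewrite /k in kb; lia.
Qed.

Lemma finite_bound X (B : seq 'cV[int]_n) : finite_set X ->
  exists K : int, forall a b, X a -> b \in B -> `|idot a b| < K.
Proof.
move=> Xfin; pose s := fset_set X.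
exists (1 + \sum_(a <- s) \sum_(b <- B) `|idot a b|) => a b Xa bB.
have as_ : a \in enum_fset s by rewrite /s in_fset_set// inE.
rewrite ltz1D (big_rem a)//= (big_rem b)//= -addrA lerDl addr_ge0// ?sumr_ge0//.
by move=> c _; rewrite sumr_ge0.
Qed.

End Escape.

(** * Series of cones and the rational functions they represent *)

Section Series.
Context {R : realType} {n : nat}.
Implicit Types (s : set 'cV[R]_n).

Lemma dual_cone_int s vs : (forall y, s y <-> incone vs y) ->
  forall a : 'rV[int]_n, dual_cone s (toR R a) <-> forall b, b \in vs -> 0 <= idot a b.
Proof.
move=> svs a; rewrite (dual_coneP svs); split=> H b bvs.
  by have := H b bvs; rewrite pairing_int ler0z.
by rewrite pairing_int ler0z H.
Qed.

(** The series [R[- m + s^vee]], whose terms are the monomials that are sections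
    of the line bundle over the chart of [s]. *)
Definition section_series s (m : 'rV[int]_n) : 'rV[int]_n -> R[i] :=
  lattice_series [set toR R (- m) + x | x in dual_cone s].

Lemma section_seriesE s m a :
  section_series s m a = (`[< dual_cone s (toR R (a + m)) >] : bool)%:R.
Proof.
rewrite /section_series /lattice_series; congr ((nat_of_bool _)%:R).
apply/idP/idP => [|/asboolP sa].
  rewrite inE => -[x sx xE]; apply/asboolP.
  by rewrite toRD -xE toRN addrC addrA subrr add0r.
rewrite inE; exists (toR R (a + m)) => //.
by rewrite -toRD addrC addrK.
Qed.

Lemma conv_subl (F : fieldType) (p q : laurent F n) (f : 'rV[int]_n -> F) a :
  conv (p - q) f a = conv p f a - conv q f a.
Proof.
pose s := undup (enum_fset (fset_set [set b | p b != 0]) ++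
                 enum_fset (fset_set [set b | q b != 0])).
have us : uniq s by exact: undup_uniq.
have ps b : p b != 0 -> b \in s by rewrite -mem_lsupp mem_undup mem_cat => ->.
have qs b : q b != 0 -> b \in s by rewrite -mem_lsupp mem_undup mem_cat orbC => ->.
rewrite !(@conv_seq _ _ _ _ _ s)//; try exact: lcoef_finite.
- by rewrite -sumrB; apply: eq_bigr => b _; rewrite -mulrBl.
- by move=> b; rewrite mulf_eq0 negb_or => /andP[/qs].
- by move=> b; rewrite mulf_eq0 negb_or => /andP[/ps].
- move=> b; rewrite mulf_eq0 negb_or => /andP[+ _]; apply: contraR => bs.
  rewrite lcoefD.
  have /negPn/eqP -> : ~~ (p b != 0) by apply: contra bs; exact: ps.
  have /negPn/eqP qb : ~~ (q b != 0) by apply: contra bs; exact: qs.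
  by apply/eqP; rewrite add0r -[LHS]/(- q b) qb oppr0.
Qed.

Lemma conv_1subl (F : fieldType) (l : 'rV[int]_n) (f : 'rV[int]_n -> F) a :
  conv (1 - lmonom F l : laurent F n) f a = f a - f (a - l).
Proof. by rewrite conv_subl !conv_monom subr0. Qed.

Lemma lmonom_1sub_neq0 (F : fieldType) (l : 'rV[int]_n) : l != 0 ->
  1 - lmonom F l != 0 :> laurent F n.
Proof.
move=> l0; apply/eqP => /(congr1 (fun p : laurent F n => p 0)).
rewrite lcoefD lcoef0 => /eqP; rewrite -[_ + _]/((0 == 0 :> 'rV[int]_n)%:R - (0 == l)%:R).
by rewrite eqxx [0 == l]eq_sym (negbTE l0) subr0 oner_eq0.
Qed.

(** The multiplier is the product of [1 - x^l] over the nonzero generators [l] of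
    the dual cone. If the product had infinite support, [escape] would give a
    point [a] of the support and a direction [u]. Since [a] is not far outside
    the cone, [u] lies in the dual cone. Let [l] be a generator with a positive
    share in [u]. The walls of the dual cone near [a] are those parallel to [u],
    and they are parallel to [l] too; so multiplication by [1 - x^l] alone
    already cancels all the terms near [a]. *)
Lemma section_series_summable s m : rational_cone s ->
  exists2 p : laurent R[i] n, p != 0 & conv p (section_series s m) \in @finsupported R[i] n.
Proof.
move=> /rational_coneP[vs [L [svs sL]]].
pose L' := [seq l <- L | l != 0].
pose P (r : seq 'rV[int]_n) : laurent R[i] n := \prod_(l <- r) (1 - lmonom R[i] l).
exists (P L').
  rewrite prodf_seq_neq0; apply/allP => l; rewrite mem_filter => /andP[l0 _].
  by apply/implyP => _; exact: lmonom_1sub_neq0.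
set f := section_series s m.
have f_eq c d : (forall b, b \in vs -> 0 <= idot (c + m) b <-> 0 <= idot (d + m) b) ->
    f c = f d.
  move=> cd; rewrite /f !section_seriesE; congr ((nat_of_bool _)%:R).
  by apply/asboolP/asboolP => /(dual_cone_int svs) H; apply/(dual_cone_int svs) => b bvs;
    apply/cd => //; exact: H.
have f_neq0 c b : f c != 0 -> b \in vs -> 0 <= idot (c + m) b.
  rewrite /f section_seriesE; have [/asboolP/(dual_cone_int svs) + _|_] := boolP `[< _ >].
    exact.
  by rewrite eqxx.
have PE l : l \in L' -> P L' = P (rem l L') * (1 - lmonom R[i] l).
  by move=> lL; rewrite /P (big_rem l lL)/= mulrC.
(* All shifts that occur when a product is expanded, with or without one factor. *)
pose W := [set b | P L' b != 0] `|` \bigcup_(l in [set` L']) [set b | P (rem l L') b != 0].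
have Wfin : finite_set W.
  rewrite finite_setU; split; first exact: lcoef_finite.
  by apply: bigcup_finite => [|l _]; [exact: finite_seq|exact: lcoef_finite].
have [K1 K1P] := finite_bound vs Wfin.
have [K2 K2P] := finite_bound vs (finite_seq (m :: L')).
apply/asboolP; apply: contrapT => /(escape vs (K1 + 2 * `|K2| + 1)) [a [u [/= nz u0 far]]].
have mK b : b \in vs -> `|idot m b| < K2 by move=> bvs; apply: K2P => //=; rewrite mem_head.
have [[b [bvs ub]]|upos] := pselect (exists b, b \in vs /\ idot u b < 0).
  have [z [pz fz]] := conv_neq0 nz.
  have := f_neq0 _ b fz bvs; rewrite !idotDl idotNl.
  have zK : `|idot z b| < K1 by apply: K1P => //; left.
  have := mK b bvs; case: (far b bvs) => [|[]|[_]]; lia.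
have us : dual_cone s (toR R u).
  apply/(dual_cone_int svs) => b bvs; rewrite leNgt; apply/negP => ub.
  by apply: upos; exists b.
have ut0 : (toR R u)^T != 0.
  apply: contra u0 => /eqP u0; apply/eqP/(@toR_inj R).
  by rewrite -[toR R u]trmxK u0 trmx0 /toR map_mx0.
have [_ [/mapP[l lL ->] l0 lP]] := incone_support (farkas sL us) ut0.
have {}l0 : l != 0 by apply: contra l0 => /eqP ->; rewrite trmx0.
have lL' : l \in L' by rewrite mem_filter l0.
have lb b : b \in vs -> idot u b = 0 -> idot l b = 0.
  move=> bvs ub; apply: (@intr_inj R); rewrite -pairing_int pairing_tr.
  have -> : (toR R l)^T = toC R l^T by rewrite /toR map_trmx.
  apply: lP => [_ /mapP[k kL ->]|]; last by rewrite -pairing_tr pairing_int ub.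
  rewrite -map_trmx -pairing_tr; apply: (sL _).1 => //.
  by apply/svs/incone_gen.
(* The translates of the cone by z and by z + l have the same membership at a. *)
move: nz; rewrite (PE l lL') conv_assoc => /conv_neq0[z [pz]].
rewrite conv_1subl subr_eq0 => /eqP; apply; apply: f_eq => b bvs.
have zK : `|idot z b| < K1 by apply: K1P => //; right; exists l.
have lK : `|idot l b| < K2 by apply: K2P => //=; rewrite mem_tail.
have := mK b bvs; rewrite !idotDl !idotNl.
case: (far b bvs) => [/lb|[_]|[ub]]; [move=> /(_ bvs) -> _|lia|].
  by rewrite oppr0 addr0.
by exfalso; apply: upos; exists b.
Qed.

(** A relation rather than the function [ratfun], because the latter is additive
    only where it is not given by its default value. *)
Definition represents (F : fieldType) (f : 'rV[int]_n -> F) (x : {fraction laurent F n}) :=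
  exists p q : laurent F n, [/\ p != 0, conv p f = q & x = tofrac q / tofrac p].

Section Represents.
Context {F : fieldType}.
Implicit Types (f g : 'rV[int]_n -> F) (x y : {fraction laurent F n}).

Lemma represents_ratfun f x : represents f x -> ratfun f = x.
Proof. by move=> [p [q [p0 pf ->]]]; exact: ratfunE. Qed.

Lemma represents_unique f x y : represents f x -> represents f y -> x = y.
Proof. by move=> /represents_ratfun <- /represents_ratfun. Qed.

Lemma represents_summable f (p : laurent F n) :
  p != 0 -> conv p f \in @finsupported F n -> represents f (ratfun f).
Proof. by move=> p0 pf; exists p, (Laurent pf); split=> //; exact: ratfunE. Qed.

Lemma represents_laurent (r : laurent F n) : represents r (tofrac r).
Proof.
exists 1, r; split; rewrite ?oner_neq0 ?tofrac1 ?divr1//.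
by apply/funext => a; rewrite conv_monom subr0.
Qed.

Lemma represents0 : represents (0 : 'rV[int]_n -> F) 0.
Proof. by have := represents_laurent 0; rewrite tofrac0. Qed.

Lemma lmul_conv (p q : laurent F n) : conv p q = p * q.
Proof. by []. Qed.

Lemma representsD f g x y : represents f x -> represents g y -> represents (f + g) (x + y).
Proof.
move=> [p [q [p0 pf ->]]] [p' [q' [p'0 pf' ->]]].
exists (p * p'), (p' * q + p * q'); split; first by rewrite mulf_neq0.
  rewrite conv_addr; apply/funext => a; rewrite lcoefD; congr (_ + _).
    by rewrite [p * p']mulrC conv_assoc pf lmul_conv.
  by rewrite conv_assoc pf' lmul_conv.
rewrite addf_div ?tofrac_eq0// tofracD !tofracM.
by congr ((_ + _) / _); rewrite mulrC.
Qed.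

Lemma representsN f x : represents f x -> represents (- f) (- x).
Proof.
move=> [p [q [p0 pf ->]]]; exists p, (- q); split=> //.
  apply: (addIr (conv p f)); rewrite -conv_addr addNr pf.
  apply/funext => a; transitivity ((- q + q : laurent F n) a) => //.
  by rewrite addNr lcoef0 conv_fset big1// => b _; rewrite mulr0.
by rewrite tofracN mulNr.
Qed.

Lemma represents_sum (I : eqType) (r : seq I) (f : I -> 'rV[int]_n -> F)
    (x : I -> {fraction laurent F n}) :
  (forall i, i \in r -> represents (f i) (x i)) ->
  represents (\sum_(i <- r) f i) (\sum_(i <- r) x i).
Proof.
move=> fx; rewrite !(big_seq_cond xpredT).
by elim/big_rec2: _ => [|i y g /andP[/fx ? _]]; [exact: represents0|exact: representsD].
Qed.

Lemma represents_periodic f (v : 'rV[int]_n) : v != 0 ->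
  (forall a, f (a - v) = f a) -> represents f 0.
Proof.
move=> v0 fv; exists (1 - lmonom F v), 0; split; first exact: lmonom_1sub_neq0.
  by apply/funext => a; rewrite conv_1subl fv subrr.
by rewrite tofrac0 mul0r.
Qed.

End Represents.

(** If no nonzero [l] vanished on [s], all of them would be positive at an interior
    point of [s], which would then be interior in the whole space. The form found
    here spans a line in the dual cone. *)
Lemma cone_dim_lt s L : cut_out s L -> (cone_dim s < n)%N ->
  exists l, [/\ l \in L, l != 0 & forall y, s y -> pairing (toR R l) y = 0].
Proof.
move=> sL; apply: contraPP => nl; rewrite ltnNge => /negP; apply.
have [y ys] := relint_nonempty sL; have sy := relint_sub ys.
have yL l : l \in L -> l != 0 -> pairing (toR R l) y != 0.
  move=> lL l0; apply/eqP => ly; apply: nl; exists l; split=> //.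
  by have [_ /(_ ly)] := (relintP sL y).1 ys l lL.
suff -> : cone_dim s = \dim {: 'cV[R]_n} by rewrite dimvf /dim/= muln1.
congr (\dim _); apply/eqP; rewrite eqEsubv subvf/=; apply/subvP => v _.
have [l lL|e e0 eL] := @near0_all R _ L (fun l t => 0 <= pairing (toR R l) (y + t *: v)).
  have [->|l0] := eqVneq l 0.
    by exists 1 => // t _ _; rewrite /toR map_mx0 pairing0l.
  have [e e0 le] := sg_perturb (pairing (toR R l) v) (yL l lL l0).
  exists e => // t t0 te; rewrite !pairingE -sgr_ge0 le// sgr_ge0.
  exact: (sL y).1.
have : y + e *: v \in lin_span s by apply/sub_lin_span/sL => l lL; exact: eL.
have : y + e *: v \in lin_span s by apply: sub_lin_span; apply/sL => l lL; exact: eL.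
rewrite (rpredDl _ (sub_lin_span sy)) => /(memvZ e^-1).
by rewrite scalerA mulVf ?gt_eqF// scale1r.
Qed.

(** A series that is invariant under translation by [l] is killed by [1 - x^l]. *)
Lemma section_series_lowdim s m : rational_cone s -> (cone_dim s < n)%N ->
  represents (section_series s m) 0.
Proof.
move=> /rational_coneP[vs [L [svs sL]]] /(cone_dim_lt sL)[l [lL l0 ls]].
apply: (represents_periodic l0) => a; rewrite !section_seriesE.
congr ((nat_of_bool _)%:R); apply/asboolP/asboolP => H y sy; have := H y sy;
  by rewrite !toRD toRN !pairingE ls// oppr0 addr0.
Qed.

(** If the support were infinite, [escape] would provide a point [a] of it and a
    direction [u] such that [a + t u] has the same sign pattern on the generators
    of all the cones for every [t >= 0]. For large real [t] the function
    [h + a + t u] is steep in a direction [y0] with [u y0 = 1], and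
    [fan_euler_vanish] says that the sum at [a] is 0. *)
Lemma signed_count_finite (Sigma : {fset set 'cV[R]_n}) h (m : set 'cV[R]_n -> 'rV[int]_n) :
  is_fan Sigma -> complete_fan Sigma -> support_function Sigma h m ->
  finite_set [set a | \sum_(s <- Sigma | `[< dual_cone s (toR R (a + m s)) >])
    (-1 : int) ^+ cone_dim s != 0].
Proof.
move=> fan compl supp.
have [rat _ _] := fan.
have ex s : exists vs, s \in Sigma -> forall y, s y <-> incone vs y.
  have [sS|] := boolP (s \in Sigma); last by exists [::].
  by have [vs [_ [svs _]]] := rational_coneP (rat _ sS).1; exists vs.
pose vs s := sval (cid (ex s)).
have svs s : s \in Sigma -> forall y, s y <-> incone (vs s) y := svalP (cid (ex s)).
pose B := flatten [seq vs s | s <- enum_fset Sigma].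
have vB s b : s \in Sigma -> b \in vs s -> b \in B.
  by move=> sS bs; apply/flattenP; exists (vs s) => //; apply/mapP; exists s.
have [K KP] := finite_bound B (finite_seq [seq m s | s <- enum_fset Sigma]).
have {}KP s b : s \in Sigma -> b \in B -> `|idot (m s) b| < K.
  by move=> sS; apply: KP => /=; apply/mapP; exists s.
apply: contrapT => /(escape B K)[a [u [/= nz u0 far]]]; case/eqP: nz.
pose U := toR R u; pose N := pairing U U^T.
have NE : N = \sum_i U 0 i ^+ 2.
  by rewrite /N /pairing mxE; apply: eq_bigr => i _; rewrite [U^T _ _]mxE expr2.
have N0 : N != 0.
  apply: contra u0; rewrite NE psumr_eq0 => [/allP U0|i _]; last exact: sqr_ge0.
  apply/eqP/(@toR_inj R)/rowP => i; have := U0 i; rewrite mem_index_enum sqrf_eq0.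
  by move=> /(_ isT)/eqP; rewrite !mxE.
pose y0 := N^-1 *: U^T.
have uy0 : pairing U y0 = 1 by rewrite pairingZr mulVf.
(* Large enough to make every linear piece have slope at least 1 along y0. *)
pose t := 1 + \sum_(s <- Sigma) `|pairing (toR R (a + m s)) y0|.
have t0 : 0 <= t by rewrite addr_ge0// sumr_ge0.
pose gs s := toR R (a + m s) + t *: U.
have dualE s : s \in Sigma -> `[< dual_cone s (toR R (a + m s)) >] = `[< dual_cone s (gs s) >].
  move=> sS; have sP := dual_coneP (svs s sS).
  have key b : b \in vs s -> (0 <= pairing (toR R (a + m s)) (toC R b)) =
      (0 <= pairing (gs s) (toC R b)).
    move=> bs; have bB := vB _ _ sS bs; rewrite !pairingE !pairing_int idotDl.
    have mK := KP _ _ sS bB.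
    case: (far b bB) => [->|[ub ab]|[ub ab]]; first by rewrite mulr0 addr0.
      have p0 : 0 <= idot a b + idot (m s) b by lia.
      rewrite ler0z p0 addr_ge0 ?ler0z// mulr_ge0// ler0z ltW//.
    have p0 : idot a b + idot (m s) b < 0 by lia.
    apply/idP/idP; first by rewrite ler0z; lia.
    have : t * (idot u b)%:~R <= 0 by rewrite mulr_ge0_le0// lerz0 ltW.
    have : (idot a b + idot (m s) b)%:~R < 0 :> R by rewrite ltrz0.
    lra.
  by apply/asboolP/asboolP => /sP H; apply/sP => b bs; have := H b bs; rewrite key.
rewrite big_mkcond/= big_seq.
rewrite -[RHS](@fan_euler_vanish R n Sigma
  (fun y => h y + pairing (toR R a + t *: U) y) gs U y0 fan compl)//.
- by rewrite [RHS]big_mkcond/= [RHS]big_seq; apply: eq_bigr => s sS; rewrite dualE.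
- move=> s sS y sy; rewrite (supp s sS y sy) /gs toRD !pairingE; ring.
- move=> s sS; rewrite /gs !pairingDl pairingZl uy0 mulr1 /t.
  rewrite (big_rem s)//=.
  have : 0 <= \sum_(j <- rem s Sigma) `|pairing (toR R (a + m j)) y0| by rewrite sumr_ge0.
  have := ler_norm (- pairing (toR R (a + m s)) y0); rewrite normrN; lra.
Qed.

End Series.

(** * Incidence numbers and the diamond property *)

Section BasisDet.
Context {R : realType} {n : nat}.
Implicit Types (V W : {vspace 'cV[R]_n}) (X Y Z : seq 'cV[R]_n) (u v w : 'cV[R]_n).

Lemma size_basis_seq V X : basis_of V X -> size X = \dim V.
Proof. by move=> bX; rewrite (size_basis (X := in_tuple X) bX). Qed.

Lemma basis_detE k (X : k.-tuple 'cV[R]_n) Z :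
  basis_det X Z = \det (\matrix_(i < k, j < k) coord X i Z`_j).
Proof.
case: X => X sX; have e := eqP sX; rewrite /basis_det /=; subst k.
by congr (\det _); apply/matrixP => i j; rewrite !mxE; congr (coord _ _ _); exact: val_inj.
Qed.

Lemma coord_expand k (X : k.-tuple 'cV[R]_n) V v : basis_of V X -> v \in V ->
  v = \sum_(i < k) coord X i v *: X`_i.
Proof. exact: coord_basis. Qed.

Lemma basis_det_mul V X Y Z : basis_of V X -> basis_of V Y ->
  (forall j, Z`_j \in V) -> basis_det X Z = basis_det X Y * basis_det Y Z.
Proof.
move=> bX bY ZV.
have sX : size X == \dim V by rewrite (size_basis_seq bX).
have sY : size Y == \dim V by rewrite (size_basis_seq bY).
pose X' := Tuple sX; pose Y' := Tuple sY.
rewrite -[X]/(tval X') -[Y]/(tval Y') !basis_detE -det_mulmx; congr (\det _).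
apply/matrixP => i j; rewrite !mxE [in LHS](coord_expand (X := Y') bY (ZV j)) linear_sum.
by apply: eq_bigr => l _; rewrite linearZ !mxE mulrC.
Qed.

Lemma basis_det_id V X : basis_of V X -> basis_det X X = 1.
Proof.
move=> bX; rewrite /basis_det -[RHS](det1 R (size X)); congr (\det _).
by apply/matrixP => i j; rewrite !mxE (coord_free (X := in_tuple X)) ?(basis_free bX)// eq_sym.
Qed.

Lemma basis_det_neq0 V X Y : basis_of V X -> basis_of V Y -> basis_det X Y != 0.
Proof.
move=> bX bY; have XV j : X`_j \in V.
  have [jX|jX] := ltnP j (size X); last by rewrite nth_default// mem0v.
  by apply: (basis_mem bX); exact: mem_nth.
have := basis_det_mul bX bY XV; rewrite (basis_det_id bX) => e.
by apply/eqP => d0; move/eqP: e; rewrite d0 mul0r oner_eq0.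
Qed.

Lemma basis_det_cons V W v X Z : basis_of V (v :: X) -> basis_of W X ->
  (forall j, Z`_j \in W) -> basis_det (v :: X) (v :: Z) = basis_det X Z.
Proof.
move=> bvX bX ZW; have fvX := basis_free bvX.
pose Y := in_tuple (v :: X); rewrite /basis_det -/Y.
have zE j : Z`_j = \sum_(l < size X) coord (in_tuple X) l Z`_j *: X`_l.
  exact: (coord_expand (X := in_tuple X) bX (ZW j)).
have cY i j : coord Y i Z`_j =
    \sum_(l < size X) coord (in_tuple X) l Z`_j * (lift ord0 l == i)%:R.
  rewrite {1}zE linear_sum; apply: eq_bigr => l _; rewrite linearZ/=; congr (_ * _).
  by rewrite -(coord_free (X := Y) (lift ord0 l) i fvX).
rewrite (expand_det_row _ ord0) big_ord_recl big1 ?addr0 => [|j _].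
  rewrite !mxE /= -[v]/(Y`_(ord0 : 'I_(size X).+1)) coord_free// eqxx mul1r.
  rewrite /cofactor addn0 expr0 mul1r; congr (\det _).
  apply/matrixP => i j; rewrite !mxE /= cY (bigD1 i)//= eqxx mulr1 big1 ?addr0// => l li.
  by rewrite (inj_eq lift_inj) (negbTE li) mulr0.
by rewrite !mxE /= cY big1 ?mul0r// => l _; rewrite mulr0.
Qed.

Lemma basis_of_cons V W v X : basis_of W X -> (W <= V)%VS -> v \in V -> v \notin W ->
  \dim V = (\dim W).+1 -> basis_of V (v :: X).
Proof.
move=> bX WV vV vW dV.
rewrite basisEfree free_cons (span_basis bX) vW (basis_free bX)/=.
rewrite span_cons (span_basis bX) /= (size_basis_seq bX) dV leqnn andbT.
by rewrite subv_add WV andbT -memvE.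
Qed.

End BasisDet.

(** With [X] a basis of [V] and [Z] a basis of a subspace [W] of codimension 2,
    this is an area form on the plane [V / W]. *)
Definition area (R : realType) n (X Z : seq 'cV[R]_n) (v w : 'cV[R]_n) : R :=
  basis_det X (v :: w :: Z).

Section AreaForm.
Context {R : realType} {n : nat}.
Variables (V W : {vspace 'cV[R]_n}) (X Z : seq 'cV[R]_n).
Hypotheses (bX : basis_of V X) (bZ : basis_of W Z) (WV : (W <= V)%VS).
Hypothesis dimVW : \dim V = (\dim W).+2.

Local Notation D := (area X Z).

Let szX : size X = (size Z).+2.
Proof. by rewrite (size_basis_seq bX) (size_basis_seq bZ). Qed.

Let X' : (size Z).+2.-tuple 'cV[R]_n := Tuple (introT eqP szX).

Let DE v w : D v w = \det (\matrix_(i < (size Z).+2, j < (size Z).+2)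
  coord X' i (v :: w :: Z)`_j).
Proof. by rewrite /area -[X]/(tval X') basis_detE. Qed.

Lemma areaN v w : D v w = - D w v.
Proof.
rewrite !DE.
set A := (X in \det X = _); set B := (X in _ = - \det X).
have -> : B = xcol ord0 (lift ord0 ord0) A.
  apply/matrixP => i j; rewrite !mxE.
  case: (unliftP ord0 j) => [j' ->|->]; last by rewrite tpermL.
  case: (unliftP ord0 j') => [j'' ->|->]; last by rewrite tpermR.
  by rewrite tpermD.
by rewrite xcolE det_mulmx det_perm odd_tperm /= expr1 mulrN1 opprK.
Qed.

(** Expand along the first column; the cofactors do not involve it. *)
Lemma area_linear a u v w : D (a *: u + v) w = a * D u w + D v w.
Proof.
pose M y := \matrix_(i < (size Z).+2, j < (size Z).+2) coord X' i (y :: w :: Z)`_j.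
have cofE y i : cofactor (M y) i ord0 = cofactor (M 0) i ord0.
  by congr (_ * \det _); apply/matrixP => k l; rewrite !mxE.
rewrite !DE !(expand_det_col _ ord0) mulr_sumr -big_split/=; apply: eq_bigr => i _.
by rewrite !cofE !mxE /= linearP mulrDl [in RHS]mulrA.
Qed.

Lemma area0l z w : z \in W -> D z w = 0.
Proof.
move=> zW.
have D0 : D 0 w = 0.
  by have := area_linear (-1) 0 0 w; rewrite scaler0 addr0 mulN1r addNr.
have alt (j : 'I_(size Z)) : D Z`_j w = 0.
  rewrite DE -det_tr.
  rewrite (@determinant_alternate _ _ _ ord0 (lift ord0 (lift ord0 j)))// => k.
  by rewrite !mxE.
rewrite (coord_expand (X := in_tuple Z) bZ zW).
elim/big_rec: _ => // j y _ Dy.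
by rewrite area_linear Dy alt mulr0 addr0.
Qed.

Lemma area_dependent v w : v \in V -> w \in V -> w \notin W -> D v w = 0 ->
  exists c z, z \in W /\ v = c *: w + z.
Proof.
move=> vV wV wW Dvw.
pose U := (<[w]> + W)%VS.
have dU : \dim U = (\dim W).+1.
  have := span_cons w Z; rewrite (span_basis bZ) => e.
  rewrite /U -e; have /eqP -> : free (w :: Z).
    by rewrite free_cons (span_basis bZ) wW (basis_free bZ).
  by rewrite /= (size_basis_seq bZ).
have bU : basis_of U (w :: Z).
  apply: (basis_of_cons bZ) => //; first exact: addvSr.
  by rewrite -[X in X \in _]addr0 memv_add ?memv_line ?mem0v// .
have [vU|vU] := boolP (v \in U).
  have [_ /vlineP[c ->] [z zW ->]] := memv_addP vU.
  by exists c, z.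
have bV : basis_of V (v :: w :: Z).
  apply: (basis_of_cons bU) => //; last by rewrite dU.
  by rewrite subv_add WV andbT -memvE.
by have := basis_det_neq0 bX bV; rewrite -[basis_det _ _]/(D v w) Dvw eqxx.
Qed.

Lemma area_span u v w : v \in V -> w \in V -> D v w != 0 -> u \in V ->
  exists a b z, z \in W /\ u = a *: v + b *: w + z.
Proof.
move=> vV wV Dvw uV.
have wW : w \notin W by apply: contra Dvw => wW; rewrite areaN area0l// oppr0.
pose a := D u w / D v w.
have : D (- a *: v + u) w = 0 by rewrite area_linear mulNr divfK// addNr.
move=> /(area_dependent _ wV wW) [|b [z [zW e]]]; first by rewrite rpredD// rpredZ.
exists a, b, z; split=> //.
by rewrite -addrA -e scaleNr addrA subrr add0r.
Qed.

(** The Pluecker relation between three vectors and a linear form [x] of the plane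
    [V / W]. It makes the order of the vectors of a half-plane by angle
    transitive. *)
Lemma area_plucker (x : 'rV[R]_n) u v w : (forall z, z \in W -> pairing x z = 0) ->
  u \in V -> v \in V -> w \in V ->
  D u w * pairing x v = D u v * pairing x w + D v w * pairing x u.
Proof.
move=> xW uV vV wV.
have Dvv y : D y y = 0 by have := areaN y y; lra.
have [Dvw|Dvw] := eqVneq (D v w) 0.
  have [wW|wW] := boolP (w \in W).
    by rewrite (xW w)// [D u w]areaN [D v w]areaN !(area0l _ wW) oppr0; ring.
  have [c [z [zW ->]]] := area_dependent vV wV wW Dvw.
  rewrite [D u (_ + _)]areaN !area_linear !pairingE !(area0l _ zW) (xW z zW) Dvv [D w u]areaN; ring.
have [a [b [z [zW ->]]]] := area_span vV wV Dvw uV.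
rewrite -addrA !area_linear !pairingE !(area0l _ zW) (xW z zW) !Dvv [D w v]areaN; ring.
Qed.

End AreaForm.

Section Diamond.
Context {R : realType} {n : nat}.
Implicit Types (r s t : set 'cV[R]_n) (v w : 'cV[R]_n).

Lemma linear_form_row (f : 'cV[R]_n -> R) : (forall a u v, f (a *: u + v) = a * f u + f v) ->
  exists x : 'rV[R]_n, forall y, pairing x y = f y.
Proof.
move=> fl; have f0 : f 0 = 0.
  by have := fl (-1) 0 0; rewrite scaler0 addr0 mulN1r addNr.
exists (\row_i f (delta_mx i 0)) => y.
rewrite [in RHS](matrix_sum_delta y) /pairing mxE.
elim/big_rec2: _ => // i a z _ ->.
by rewrite big_ord1 fl mxE mulrC.
Qed.

Lemma face_subset r s : face r s -> r `<=` s.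
Proof. by move=> [x [_ ->]] v []. Qed.

Lemma face_span r s v : face r s -> s v -> v \in lin_span r -> r v.
Proof.
move=> [x [_ ->]] sv vr; split=> //=.
by apply: lin_span_ker vr => y [].
Qed.

Definition facet r s : Prop := face r s /\ cone_dim s = (cone_dim r).+1.

Lemma facet_outside r s : facet r s -> exists v, (s `\` r) v.
Proof.
move=> [rs dimrs]; apply: contrapT => nv.
have sr : s `<=` r by move=> v sv; apply: contrapT => rv; apply: nv; exists v.
have e : r = s by apply/seteqP; split=> //; exact: face_subset.
by move: dimrs; rewrite e => /n_Sn.
Qed.

Lemma basis_of_facet r s v Z : facet r s -> basis_of (lin_span r) Z -> (s `\` r) v ->
  basis_of (lin_span s) (v :: Z).
Proof.
move=> [rs dimrs] bZ [sv rv]; apply: (basis_of_cons bZ) => //.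
- by apply: lin_span_sub; exact: face_subset.
- exact: sub_lin_span.
- by apply/negP => vr; apply: rv; exact: (face_span rs sv vr).
Qed.

Variables (Sigma : {fset set 'cV[R]_n}) (o : set 'cV[R]_n -> seq 'cV[R]_n).
Hypotheses (fan : is_fan Sigma) (ori : orientation Sigma o).

Lemma incidence_facet r s : incidence o s r != 0 -> facet r s.
Proof.
rewrite /incidence; case: ifP => [/andP[/asboolP rs /eqP dimrs] _|_]; last by rewrite eqxx.
by split.
Qed.

(** An inward vector of [s] at [r], one of [r] at [t] and the basis of [t] form a
    basis of [s]; by multiplicativity of determinants its orientation is the
    product of the two incidence numbers. *)
Lemma incidence_mul r s t : s \in Sigma -> r \in Sigma -> t \in Sigma ->
  facet r s -> facet t r -> exists v w, [/\ (s `\` r) v, (r `\` t) w &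
    incidence o s r * incidence o r t = sgz (area (o s) (o t) v w)].
Proof.
move=> sS rS tS frs ftr; have [ob _] := ori.
pose v := xget 0 (s `\` r); pose w := xget 0 (r `\` t).
have sv : (s `\` r) v by apply: (@xgetPex _ 0 (s `\` r)); exact: facet_outside.
have rw : (r `\` t) w by apply: (@xgetPex _ 0 (r `\` t)); exact: facet_outside.
exists v, w; split=> //.
have [rs dimrs] := frs; have [tr dimtr] := ftr.
rewrite /incidence -/v -/w !asboolT// dimrs dimtr !eqxx/= -sgzM /area.
have bvr := basis_of_facet frs (ob _ rS) sv.
have bwt := basis_of_facet ftr (ob _ tS) rw.
have entry (Z : seq 'cV[R]_n) (V : {vspace 'cV[R]_n}) j : basis_of V Z -> Z`_j \in V.
  move=> bZ; have [jZ|jZ] := ltnP j (size Z); last by rewrite nth_default// mem0v.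
  by apply: (basis_mem bZ); exact: mem_nth.
rewrite (basis_det_mul (Z := v :: w :: o t) (ob _ sS) bvr); last first.
  case=> [|j] /=; first exact/sub_lin_span/sv.1.
  have /subvP : (lin_span r <= lin_span s)%VS by apply: lin_span_sub; exact: face_subset.
  by move=> sub; apply: sub; exact: (entry _ _ j bwt).
by rewrite (basis_det_cons bvr (ob _ rS))// => j; exact: (entry _ _ j bwt).
Qed.

Section Interval.
Variables (s t : set 'cV[R]_n).
Hypotheses (sS : s \in Sigma) (tS : t \in Sigma).
Hypotheses (ts : face t s) (dimts : cone_dim s = (cone_dim t).+2).

Let bs : basis_of (lin_span s) (o s) := ori.1 s sS.
Let bt : basis_of (lin_span t) (o t) := ori.1 t tS.
Local Notation D := (area (o s) (o t)).
Let subts : (lin_span t <= lin_span s)%VS.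
Proof. by apply: lin_span_sub; exact: face_subset. Qed.

(** Both the form that cuts out [r] and [D _ w] vanish on the hyperplane spanned by
    [r], so they are proportional on the span of [s]. *)
Lemma facet_sign r v w (e : R) : facet r s -> facet t r -> (s `\` r) v -> (r `\` t) w ->
  0 < e * D v w -> forall u, s u -> 0 <= e * D u w.
Proof.
move=> [rs _] [tr _] [sv nrv] [rw _] eD u su.
have Dvw : D v w != 0 by apply: contraTneq eD => ->; rewrite mulr0 ltxx.
have [x [xs rE]] := rs; have xr y : r y -> pairing x y = 0 by rewrite rE => -[].
have [a [b [z [zt uE]]]] := area_span bs bt subts dimts
  (sub_lin_span sv) (sub_lin_span (face_subset rs rw)) Dvw (sub_lin_span su).
have xz : pairing x z = 0.
  by apply: lin_span_ker zt => y /(face_subset tr)/xr.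
have xv : 0 < pairing x v.
  rewrite lt_def xs// andbT; apply/eqP => xv; apply: nrv.
  by rewrite rE; split.
have := xs _ su; rewrite {1}uE !pairingE xz (xr _ rw) mulr0 !addr0 pmulr_lge0// => a0.
have Dww : D w w = 0 by have := areaN bs bt dimts w w; lra.
rewrite uE -addrA !(area_linear bs bt dimts) (area0l bs bt dimts _ zt) Dww.
by rewrite mulr0 !addr0 mulrCA mulr_ge0// ltW.
Qed.

(** By [facet_sign], once for each of the two facets, [e * D w' w] and [e * D w w']
    are nonnegative; being opposite they vanish, so [w] and [w'] are proportional
    modulo the span of [t]. *)
Lemma facet_subset_sign r v w r' v' w' (e : R) :
  facet r s -> facet t r -> (s `\` r) v -> (r `\` t) w ->
  facet r' s -> facet t r' -> (s `\` r') v' -> (r' `\` t) w' ->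
  0 < e * D v w -> 0 < e * D v' w' -> r' `<=` r.
Proof.
move=> frs ftr sv rw frs' ftr' sv' rw' eD eD'.
have [rs _] := frs; have [rs' _] := frs'.
have sw := face_subset rs rw.1; have sw' := face_subset rs' rw'.1.
have le1 := facet_sign frs ftr sv rw eD sw'.
have le2 := facet_sign frs' ftr' sv' rw' eD' sw.
have e0 : e != 0 by apply: contraTneq eD => ->; rewrite mul0r ltxx.
have D0 : D w' w = 0.
  apply: (mulfI e0); rewrite mulr0; apply/eqP; rewrite eq_le le1 andbT.
  by move: le2; rewrite (areaN bs bt dimts w w') mulrN oppr_ge0.
have wt : w \notin lin_span t.
  apply: contraTN eD => wt; rewrite (areaN bs bt dimts) (area0l bs bt dimts _ wt).
  by rewrite oppr0 mulr0 ltxx.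
have [c [z [zt w'E]]] := area_dependent bs bt subts dimts (sub_lin_span sw')
  (sub_lin_span sw) wt D0.
have [x [xs rE]] := rs; have xr y : r y -> pairing x y = 0 by rewrite rE => -[].
have xt y : y \in lin_span t -> pairing x y = 0.
  by apply: lin_span_ker => ? /(face_subset ftr.1)/xr.
have xw' : pairing x w' = 0 by rewrite w'E !pairingE (xr _ rw.1) xt// mulr0 addr0.
move=> u r'u; rewrite rE; split; first exact: (face_subset rs').
have := sub_lin_span r'u; rewrite -(span_basis (basis_of_facet ftr' bt rw')) span_cons.
move=> /memv_addP[_ /vlineP[d ->] [y + ->]].
by rewrite /= (span_basis bt) => /xt xy; rewrite !pairingE xw' xy mulr0 addr0.
Qed.

(** Modulo the span of [t] the cone [s] is a plane cone on whose nonzero vectors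
    [x] is positive. So its generators are ordered by angle, and an extreme one
    exists. *)
Lemma extreme_generator (e : R) : exists g, [/\ s g, ~ t g & forall v, s v -> 0 <= e * D v g].
Proof.
have [rat _ _] := fan; have [vs [_ [svs _]]] := rational_coneP (rat _ sS).1.
have [x [xs tE]] := ts.
have xt y : y \in lin_span t -> pairing x y = 0.
  by apply: lin_span_ker => ?; rewrite tE => -[].
have Dvv y : D y y = 0 by have := areaN bs bt dimts y y; lra.
have [g0 [sg0 xg0]] : exists g, s g /\ 0 < pairing x g.
  apply: contrapT => ng; have e0 : t = s.
    apply/seteqP; split; first exact: face_subset.
    move=> v sv; rewrite tE; split=> //=; apply: contrapT => /eqP xv.
    by apply: ng; exists v; split=> //; rewrite lt_def xv xs.
  by move: dimts; rewrite e0; lia.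
have [g [sg xg gP]] : exists g, [/\ s g, 0 < pairing x g &
    forall v : 'cV[int]_n, v \in vs -> 0 <= e * D (toC R v) g].
  have sub : {subset vs <= vs} by [].
  elim: {1 3}vs sub => [_|v l IH sub]; first by exists g0; split.
  have [|g [sg xg gl]] := IH; first by move=> k kl; apply: sub; rewrite mem_tail.
  have [le|lt] := leP 0 (e * D (toC R v) g).
    by exists g; split=> // k; rewrite inE => /predU1P[->//|/gl].
  have sgen k : k \in vs -> s (toC R k) by move=> kvs; apply/svs/incone_gen.
  have sv : s (toC R v) by apply/sgen/sub; rewrite mem_head.
  have xv : 0 < pairing x (toC R v).
    rewrite lt_def xs// andbT; apply: contraTneq lt => xv0; rewrite -leNgt.
    rewrite (area0l bs bt dimts) ?mulr0//; apply: sub_lin_span.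
    by rewrite tE; split.
  exists (toC R v); split=> // k; rewrite inE => /predU1P[->|kl].
    by rewrite Dvv mulr0.
  have kvs : k \in vs by apply: sub; rewrite mem_tail.
  have := area_plucker bs bt subts dimts xt (sub_lin_span (sgen k kvs))
    (sub_lin_span sg) (sub_lin_span sv).
  move: (gl k kl) (xs _ (sgen k kvs)); rewrite (areaN bs bt dimts g) => Dk xk pl.
  rewrite -(pmulr_lge0 _ xg) -mulrA pl mulrDr mulNr mulrN addr_ge0//.
    by rewrite mulrA mulr_ge0// ltW.
  by rewrite oppr_ge0 mulrA mulr_le0_ge0// ltW.
exists g; split=> // [|v sv].
  by move=> /sub_lin_span/xt xg0'; rewrite xg0' ltxx in xg.
have [|y yP] := @linear_form_row (fun v => e * D v g).
  by move=> a u w; rewrite (area_linear bs bt dimts); ring.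
rewrite -yP; apply: (incone_ge0 ((svs v).1 sv)) => b bvs.
by rewrite yP; exact: gP.
Qed.

(** The facet is the intersection of [s] with the hyperplane spanned by [t] and an
    extreme generator. *)
Lemma facet_exists (e : R) : e != 0 -> exists r, [/\ r \in Sigma, facet r s, facet t r &
  forall v w, (s `\` r) v -> (r `\` t) w -> 0 < e * D v w].
Proof.
move=> e0; have [g [sg ntg gP]] := extreme_generator e.
have [x [xs tE]] := ts.
have xt y : y \in lin_span t -> pairing x y = 0.
  by apply: lin_span_ker => ?; rewrite tE => -[].
have xpos v : s v -> ~ t v -> 0 < pairing x v.
  move=> sv ntv; rewrite lt_def xs// andbT; apply/eqP => xv; apply: ntv.
  by rewrite tE.
have gt : g \notin lin_span t by apply/negP => /xt xg; have := xpos g sg ntg; rewrite xg ltxx.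
have [|y yP] := @linear_form_row (fun v => e * D v g).
  by move=> a u w; rewrite (area_linear bs bt dimts); ring.
pose r := s `&` [set v | pairing y v = 0].
have rs : face r s.
  by exists y; split=> // v sv; rewrite yP; exact: gP.
have rP v : r v -> exists c z, z \in lin_span t /\ v = c *: g + z.
  move=> [sv /= yv]; apply: (area_dependent bs bt subts dimts) => //; try exact: sub_lin_span.
  by apply: (mulfI e0); rewrite mulr0 -yP.
have sub_tr : t `<=` r.
  move=> v tv; split; first exact: (face_subset ts).
  by rewrite /= yP (area0l bs bt dimts) ?mulr0//; exact: sub_lin_span.
have rg : r g.
  split=> //=; rewrite yP; have -> : D g g = 0 by have := areaN bs bt dimts g g; lra.
  by rewrite mulr0.
have tr : face t r.
  exists x; split=> [v [sv _]|]; first exact: xs.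
  apply/seteqP; split=> v; first by move=> tv; split; [exact: sub_tr|rewrite tE in tv; case: tv].
  by move=> [[sv _] xv]; rewrite tE.
have dimr : cone_dim r = (cone_dim t).+1.
  have -> : cone_dim r = \dim (<[g]> + lin_span t)%VS.
    congr (\dim _); apply/eqP; rewrite eqEsubv subv_add lin_span_sub// andbT.
    rewrite -memvE sub_lin_span// andbT; apply: lin_span_min => v /rP[c [z [zt ->]]].
    by rewrite memv_add// memvZ// memv_line.
  rewrite -(span_basis bt) -span_cons.
  have /eqP -> : free (g :: o t) by rewrite free_cons (span_basis bt) gt (basis_free bt).
  by rewrite /= (size_basis_seq bt).
exists r; split.
- by case: fan => _ /(_ s r sS rs).
- by split=> //; rewrite dimts dimr.
- by [].
move=> v w [sv nrv] [rw ntw].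
have [c [z [zt wE]]] := rP _ rw.
have c0 : 0 < c.
  have := xpos w rw.1 ntw; rewrite wE !pairingE (xt _ zt) addr0 pmulr_lgt0//.
  exact: xpos.
have -> : D v w = c * D v g.
  by rewrite (areaN bs bt dimts) wE (area_linear bs bt dimts) (area0l bs bt dimts _ zt)
    addr0 -mulrN -(areaN bs bt dimts).
rewrite mulrCA pmulr_rgt0// lt_def gP// andbT -yP; apply/eqP => yv.
by apply: nrv; split.
Qed.

Lemma sgz_eq (d : R) (e : int) : e = 1 \/ e = -1 -> (sgz d = e) <-> 0 < e%:~R * d.
Proof.
case=> ->; rewrite ?mul1r ?mulN1r ?oppr_gt0; split.
- by move=> /eqP; rewrite sgz_cp0.
- by move=> d0; apply/eqP; rewrite sgz_cp0.
- by move=> /eqP; rewrite sgz_cp0.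
- by move=> d0; apply/eqP; rewrite sgz_cp0.
Qed.

(** Between cones whose dimensions differ by 2 there are exactly two facets, one
    for each side of the plane cone [s / t], and their products of incidence
    numbers are opposite. *)
Lemma diamond (e : int) : e = 1 \/ e = -1 ->
  exists r, [/\ r \in Sigma, face r s, incidence o s r * incidence o r t = e &
    forall r', r' \in Sigma -> incidence o s r' * incidence o r' t = e -> r' = r].
Proof.
move=> eE; have e0 : e%:~R != 0 :> R by case: eE => ->; rewrite ?oppr_eq0 oner_eq0.
have [r [rS frs ftr rP]] := facet_exists e0.
have [v [w [sv rw vw]]] := incidence_mul sS rS tS frs ftr.
exists r; split=> //; first by case: frs.
  by rewrite vw; apply/sgz_eq => //; exact: rP.
move=> r' r'S er'.
have frs' : facet r' s.
  apply: incidence_facet; apply: contra_eq_neq er' => ->.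
  by rewrite mul0r; case: eE => ->.
have ftr' : facet t r'.
  apply: incidence_facet; apply: contra_eq_neq er' => ->.
  by rewrite mulr0; case: eE => ->.
have [v' [w' [sv' rw' vw']]] := incidence_mul sS r'S tS frs' ftr'.
have p := rP _ _ sv rw.
have p' : 0 < e%:~R * D v' w' by apply/(sgz_eq _ eE); rewrite -vw'.
apply/seteqP; split.
  exact: (facet_subset_sign frs ftr sv rw frs' ftr' sv' rw' p p').
exact: (facet_subset_sign frs' ftr' sv' rw' frs ftr sv rw p' p).
Qed.

End Interval.
End Diamond.

(** * The cochain complex and its Euler characteristic *)

Section Complex.
Context {R : realType} {n : nat}.
Variables (Sigma : {fset set 'cV[R]_n}) (h : 'cV[R]_n -> R).
Variables (m : set 'cV[R]_n -> 'rV[int]_n) (o : set 'cV[R]_n -> seq 'cV[R]_n).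
Hypotheses (fan : is_fan Sigma) (supp : support_function Sigma h m).
Hypothesis ori : orientation Sigma o.

(** Restriction of sections: [h] is given on [r] by the linear form of [s] too. *)
Lemma section_face b s r : s \in Sigma -> r \in Sigma -> face r s ->
  lmonom R[i] b \in sections (m s) s -> lmonom R[i] b \in sections (m r) r.
Proof.
move=> sS rS rs; rewrite !inE => /lmonom_sections sb; apply/lmonom_sections => y ry.
have sy := face_subset rs ry.
have := sb y sy; rewrite !toRD !pairingDl -(supp rS ry) -(supp sS sy).
exact.
Qed.

Lemma incidence_sum b k (s : cell Sigma m b k) (t : cell Sigma m b k.+2) :
  \sum_(r : cell Sigma m b k.+1)
    incidence o (val (val s)) (val (val r)) * incidence o (val (val r)) (val (val t)) = 0.
Proof.
have /andP[/eqP ds secs] := valP s; have /andP[/eqP dt _] := valP t.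
have sS : val (val s) \in Sigma := valP (val s).
have tS : val (val t) \in Sigma := valP (val t).
set s' := val (val s) in ds secs sS *; set t' := val (val t) in dt tS *.
have dst : cone_dim s' = (cone_dim t').+2 by lia.
have [ts|nts] := pselect (face t' s'); last first.
  rewrite big1 // => r _; apply/eqP; apply: contra_notT nts.
  rewrite mulf_eq0 negb_or => /andP[/incidence_facet[/face_subset rs _]].
  move=> /incidence_facet[/face_subset tr _].
  (* A nonzero term gives t inside s, and the fan axioms make it a face of s. *)
  have [_ _ /(_ _ _ sS tS)[+ _]] := fan.
  by rewrite (_ : s' `&` t' = t')//; apply/setIidr => y /tr/rs.
have mk e : e = 1 \/ e = -1 -> exists r : cell Sigma m b k.+1,
    incidence o s' (val (val r)) * incidence o (val (val r)) t' = e /\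
    forall r' : cell Sigma m b k.+1,
      incidence o s' (val (val r')) * incidence o (val (val r')) t' = e -> r' = r.
  move=> eE; have [r [rS rs re runiq]] := diamond fan ori sS tS ts dst eE.
  have [_ dr] : facet r s'.
    apply: (@incidence_facet _ _ o); apply: contra_eq_neq re => ->.
    by rewrite mul0r; case: eE => ->.
  have rP : (cone_dim (val [` rS]%fset) + k.+1 == n)%N &&
      (lmonom R[i] b \in sections (m (val [` rS]%fset)) (val [` rS]%fset)).
    by rewrite /= (section_face sS rS rs secs) andbT; apply/eqP; lia.
  exists (Sub [` rS]%fset rP); split; first by rewrite SubK.
  move=> r' r'e; apply/val_inj/val_inj; rewrite SubK /=; exact: runiq (valP (val r')) r'e.
have [rp [rpe rpu]] := mk 1 (or_introl erefl).
have [rm [rme rmu]] := mk (-1) (or_intror erefl).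
have pm : rm != rp by apply: contra_eq_neq rme => ->; rewrite rpe.
rewrite (bigD1 rp)//= rpe (bigD1 rm)//= rme big1 ?addr0// => r /andP[rrp rrm].
apply/eqP; apply: contraT => nz.
have [f1 f2] : facet (val (val r)) s' /\ facet t' (val (val r)).
  move: nz; rewrite mulf_eq0 negb_or => /andP[].
  by move=> /incidence_facet ? /incidence_facet.
have rS : val (val r) \in Sigma := valP (val r).
have [v [w [_ _ vw]]] := incidence_mul ori sS rS tS f1 f2.
move: nz; rewrite vw sgz_eq0; case: ltgtP => // d0 _.
  by case/eqP: rrm; apply: rmu; rewrite vw ltr0_sgz.
by case/eqP: rrp; apply: rpu; rewrite vw gtr0_sgz.
Qed.

Lemma differentialK b k (w : cochain Sigma m b k) :
  differential o (differential o w) = 0.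
Proof.
apply/ffunP => t; rewrite !ffunE.
under eq_bigr do rewrite ffunE mulr_sumr.
rewrite exchange_big big1//= => s _.
under eq_bigr do rewrite mulrA -intrM mulrC.
rewrite -mulr_sumr -rmorph_sum/= (eq_bigr (fun r : cell Sigma m b k.+1 =>
  incidence o (val (val s)) (val (val r)) * incidence o (val (val r)) (val (val t)))).
  by rewrite incidence_sum mulr0.
by move=> r _; rewrite mulrC.
Qed.

Local Notation dimZ b k := (\dim (cocycles Sigma m o b k)).
Local Notation dimB b k := (\dim (coboundaries Sigma m o b k)).

Lemma coboundary_le b k : (dimB b k <= dimZ b k)%N.
Proof.
case: k => [|k]; first by rewrite /= dimv0.
apply/dimvS/subvP => _ /memv_imgP[w _ ->].
by rewrite memv_ker !lfunE /= differentialK.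
Qed.

Lemma cocycle_coboundary b k : (dimZ b k + dimB b k.+1 = #|cell Sigma m b k|)%N.
Proof.
have := limg_ker_dim (linfun (@differential R n Sigma m o b k)) fullv.
by rewrite capfv dimvf /dim/= muln1.
Qed.

Lemma cell_empty b : #|cell Sigma m b n.+1| = 0%N.
Proof.
apply: eq_card0 => s; have /andP[/eqP ds _] := valP s.
by exfalso; lia.
Qed.

(** Rank-nullity. That coboundaries are cocycles is what makes the difference of
    dimensions in the definition of the cohomology an honest one; the last
    coboundary space vanishes because no cone has codimension [n.+1]. *)
Lemma euler_char_cells b :
  euler_char Sigma m o b = \sum_(k < n.+1) (-1) ^+ k * (#|cell Sigma m b k|)%:Z.
Proof.
suff H N : \sum_(k < N) (-1) ^+ k * (cohomology_dim Sigma m o b k)%:Z =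
    \sum_(k < N) (-1) ^+ k * (#|cell Sigma m b k|)%:Z + (-1) ^+ N * (dimB b N)%:Z.
  rewrite /euler_char H; have := cocycle_coboundary b n.+1; rewrite cell_empty => z.
  have := coboundary_le b n.+1; rewrite (_ : dimB b n.+1 = 0%N) ?mulr0 ?addr0//.
  by apply/eqP; rewrite -leqn0; apply: leq_trans (coboundary_le b n.+1) _; lia.
elim: N => [|N IH]; first by rewrite !big_ord0 /= dimv0 mulr0 addr0.
rewrite !big_ord_recr/= IH -!addrA; congr (_ + _).
rewrite -mulrDr exprS mulN1r mulNr -mulrBr; congr (_ * _).
rewrite -(cocycle_coboundary b N) /cohomology_dim -subzn ?coboundary_le// PoszD/=.
by rewrite addrK addrC subrK.
Qed.

Lemma cone_dim_le (s : set 'cV[R]_n) : (cone_dim s <= n)%N.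
Proof. by have := dimvS (subvf (lin_span s)); rewrite dimvf /dim/= muln1. Qed.

Lemma euler_char_cones b : euler_char Sigma m o b =
  \sum_(s <- Sigma | `[< dual_cone s (toR R (b + m s)) >]) (-1) ^+ (n + cone_dim s).
Proof.
rewrite euler_char_cells big_seq_fsetE [RHS]big_mkcond/=.
transitivity (\sum_(k < n.+1) \sum_(s : Sigma)
    (if (cone_dim (val s) + k == n)%N && (lmonom R[i] b \in sections (m (val s)) (val s))
     then (-1 : int) ^+ k else 0)).
  apply: eq_bigr => k _; rewrite -big_mkcond/= sumr_const card_sig -mulr_natr.
  by congr (_ * _); rewrite natz.
rewrite exchange_big/=; apply: eq_bigr => s _.
have dn := cone_dim_le (val s).
have -> : (lmonom R[i] b \in sections (m (val s)) (val s)) =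
    `[< dual_cone (val s) (toR R (b + m (val s))) >].
  by apply/idP/asboolP; rewrite inE lmonom_sections.
case: asboolP => _; last by rewrite big1// => k _; rewrite andbF.
rewrite (bigD1 (inord (n - cone_dim (val s))))//= inordK ?ltnS ?leq_subr//.
rewrite subnKC// eqxx big1 ?addr0 => [|k kn].
  by rewrite -[LHS]signr_odd oddB// -oddD signr_odd.
rewrite andbT; case: eqP => // e; case/eqP: kn; apply/val_inj.
by rewrite /= inordK; lia.
Qed.

End Complex.

Lemma represents_sign (F : fieldType) n (f : 'rV[int]_n -> F) k :
  represents f 0 -> represents (fun a => (-1) ^+ k * f a) 0.
Proof.
move=> f0; case: (boolP (odd k)) => ok.
  rewrite (_ : (fun _ => _) = - f); first by rewrite -oppr0; exact: representsN.
  by apply/funext => a; rewrite -signr_odd ok mulN1r.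
rewrite (_ : (fun _ => _) = f)//; apply/funext => a.
by rewrite -signr_odd (negbTE ok) mul1r.
Qed.

Theorem theorem1p2 (R : realType) (n : nat) (Sigma : {fset set 'cV[R]_n})
    (h : 'cV[R]_n -> R) (m : set 'cV[R]_n -> 'rV[int]_n)
    (o : set 'cV[R]_n -> seq 'cV[R]_n) :
  is_fan Sigma -> complete_fan Sigma ->
  support_function Sigma h m -> orientation Sigma o ->
  exists r : laurent R[i] n,
    fan_ratfun Sigma m = tofrac r /\
    forall a : 'rV[int]_n, r a = (euler_char Sigma m o a)%:~R.
Proof.
move=> fan compl supp ori; have [rat _ _] := fan.
have chi_fin : (fun a => (euler_char Sigma m o a)%:~R : R[i]) \in @finsupported R[i] n.
  apply/asboolP; apply: sub_finite_set (signed_count_finite fan compl supp) => a /=.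
  apply: contraNneq => chi0; rewrite (euler_char_cones fan supp ori).
  under eq_bigr do rewrite exprD.
  by rewrite -mulr_sumr chi0 mulr0.
pose r := Laurent chi_fin; exists r; split=> //.
pose f s a := (-1 : R[i]) ^+ (n + cone_dim s) * section_series s (m s) a.
pose x s := if cone_dim s == n then ratfun (section_series s (m s)) else 0.
have rE : \sum_(s <- Sigma) f s = r.
  apply/funext => a; rewrite /= (euler_char_cones fan supp ori) fct_sumE.
  rewrite rmorph_sum/= [RHS]big_mkcond; apply: eq_bigr => s _.
  rewrite /f section_seriesE; case: asboolP => _; last by rewrite mulr0.
  by rewrite mulr1 rmorphXn/= rmorphN1.
apply: (represents_unique (f := r)); last exact: represents_laurent.
rewrite -rE /fan_ratfun [X in represents _ X]big_mkcond.
apply: (@represents_sum _ _ _ _ f x) => s sS; rewrite /x.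
have rs := (rat s sS).1; have [dn|dn] := eqVneq (cone_dim s) n.
  have [p p0 pf] := section_series_summable (m s) rs.
  have -> : f s = section_series s (m s); last exact: represents_summable pf.
  by apply/funext => a; rewrite /f dn addnn -signr_odd odd_double mul1r.
apply/represents_sign/(section_series_lowdim _ rs).
by rewrite ltn_neqAle dn cone_dim_le.
Qed.
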